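(* Assume (SC), and let $\mathcal R=\max\{\tilde\mu/\mu,\;L/\tilde l,\;1\}$. Throughout a run of AGDA+, $L_t$ increases and $\mu_t$ decreases (i.e. the update $L_t\leftarrow L_t/\gamma_1$, $\mu_t\leftarrow\max\{\mu_t\gamma_1,\underline\mu\}$ of step (3) is carried out) at most $\lceil\frac1r\log_{1/\gamma}(\mathcal R)\rceil$ times. Moreover, let $I_t$ denote the number of times $\mathrm{BC}(t)$ is checked within iteration $t\in\mathbb N$. Then $\frac1{T+1}\sum_{t=0}^{T}I_t\le2+\frac{\log_{1/\gamma}(\mathcal R)}{T+1}$ for all $T\in\mathbb N$; hence $\frac1{T+1}\sum_{t=0}^{T}I_t\le3$ for all $T\ge\lfloor\log_{1/\gamma}(\mathcal R)\rfloor$, and $\limsup_{T\to\infty}\frac1{T+1}\sum_{t=0}^TI_t\le2$.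
   Context: Setting. $\mathcal X,\mathcal Y$ are finite-dimensional Euclidean spaces with Euclidean norm $\|\cdot\|$; $\mathbb N=\{0,1,2,\dots\}$, $\mathbb N_+=\mathbb N\setminus\{0\}$. Problem: $\min_{x\in\mathcal X}\max_{y\in\mathcal Y}\mathcal L(x,y)$ with $\mathcal L(x,y)=g(x)+f(x,y)-h(y)$. Assumption (SC): $g:\mathcal X\to\mathbb R\cup\{+\infty\}$ and $h:\mathcal Y\to\mathbb R\cup\{+\infty\}$ are proper closed convex; $f:\mathcal X\times\mathcal Y\to\mathbb R$ is differentiable on an open set containing $\mathrm{dom}\,g\times\mathrm{dom}\,h$; $\nabla f$ is $L$-Lipschitz on $\mathrm{dom}\,g\times\mathrm{dom}\,h$; and $f(x,\cdot)$ is strongly concave with modulus $\mu>0$ for every $x\in\mathrm{dom}\,g$. Notation: $\mathbf{prox}_{r}(x)=\arg\min_w\{r(w)+\frac12\|w-x\|^2\}$; $G_x^\tau(x,y)=[x-\mathbf{prox}_{\tau g}(x-\tau\nabla_xf(x,y))]/\tau$; $G_y^\sigma(x,y)=[\mathbf{prox}_{\sigma h}(y+\sigma\nabla_yf(x,y))-y]/\sigma$. $\mathcal D_y=\sup_{y_1,y_2\in\mathrm{dom}\,h}\|y_1-y_2\|$. Algorithm AGDA+. Inputs: $(x_0,y_0)\in\mathrm{dom}\,g\times\mathrm{dom}\,h$; $\zeta,\tilde\mu,\tilde l>0$ with $\tilde l>\tilde\mu$; $\gamma_0,\gamma\in(0,1)$; $r\in\mathbb N_+$; a Boolean $\texttt{max\_solver}$.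 Put $\gamma_1=\gamma^r$, $\gamma_2=\gamma$. If $\mu$ is known, $\underline\mu=\tilde\mu=\mu$; otherwise $\underline\mu=0$. $\bar{\mathcal D}_y=\mathcal D_y$ if $\mathcal D_y<\infty$ is known, otherwise $\bar{\mathcal D}_y=+\infty$. Initialize $l_0=L_0=\tilde l$, $\mu_0=\tilde\mu$, $t=0$, $l_0^\circ=l_0$, $\texttt{flag}=\texttt{False}$. Repeat: (1) If $\texttt{max\_solver}=\texttt{True}$ and $\texttt{flag}=\texttt{False}$, replace $y_t$ by a point satisfying $\mathcal L(x_t,y_t)+\zeta\ge\max_{y}\mathcal L(x_t,y)$. If $\texttt{max\_solver}=\texttt{False}$, set $\hat y_t=\mathbf{prox}_{h/L_t}(y_t+\frac1{L_t}\nabla_yf(x_t,y_t))$, $d_t=\|\hat y_t-y_t\|$, then $y_t\leftarrow\hat y_t$. Set $\texttt{flag}\leftarrow\texttt{True}$. (2) While $l_t\le L_t$: (2a) $\sigma_t=1/l_t$, $\tau_t=\frac{1-\gamma_0}{l_t}\Big(4+\frac1{\gamma_2}+\frac{4(1-\sigma_t\mu_t)(2-\sigma_t\mu_t)(15L_t-8\mu_t)L_t^3}{\mu_t^4}\Big)^{-1}$, $\tilde x_{t+1}=\mathbf{prox}_{\tau_tg}(x_t-\tau_t\nabla_xf(x_t,y_t))$, $\tilde y_{t+1}=\mathbf{prox}_{\sigma_th}(y_t+\sigma_t\nabla_yf(\tilde x_{t+1},y_t))$. (2b) If $\texttt{flag}=\texttt{True}$: set $R_t=0$ and, if $\texttt{max\_solver}=\texttt{True}$,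 $\Delta_t=\frac{2\zeta}{\mu_t}$, $\Lambda_t=\zeta+\sqrt{2\zeta/\mu_t}\,L_t\|y_t-\tilde y_{t+1}\|$; if $\texttt{max\_solver}=\texttt{False}$, $\Delta_t=\min\{(1+\frac{2L_t}{\mu_t})^2d_t^2,\bar{\mathcal D}_y^2\}$, $\Lambda_t=2d_tL_t\|y_t-\tilde y_{t+1}\|$. (2c) Check $\mathrm{BC}(t)$. If it holds: $x_{t+1}=\tilde x_{t+1}$, $y_{t+1}=\tilde y_{t+1}$, $l_{t+1}=l_{t+1}^\circ=\max\{\gamma_2l_t,\tilde l\}$, $L_{t+1}=L_t$, $\mu_{t+1}=\mu_t$, $C_t=\frac{(1-\sigma_t\mu_t)(2-\sigma_t\mu_t)}{\sigma_t\mu_t}\frac{L_t^2}{\mu_t^2}\tau_t^2$, $\Delta_{t+1}=(1-\mu_t\sigma_t/2)\Delta_t+C_t\|G_x^{\tau_t}(x_t,y_t)\|^2$, $\Lambda_{t+1}=6l_t(\Delta_{t+1}+2\Delta_t)-8\mu_t\Delta_t$, $R_{t+1}=2\tau_t^2l_t\|G_x^{\tau_t}(x_t,y_t)\|^2-\sigma_t^2\mu_t\|G_y^{\sigma_t}(x_{t+1},y_t)\|^2$, then $t\leftarrow t+1$, $\texttt{flag}\leftarrow\texttt{False}$. If it fails: $l_t\leftarrow l_t/\gamma_2$. (3) (when $l_t>L_t$) $L_t\leftarrow L_t/\gamma_1$, $\mu_t\leftarrow\max\{\mu_t\gamma_1,\underline\mu\}$, return to (1). Backtracking condition $\mathrm{BC}(t)$: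 all four of (i) $(\tau_t-(2+\frac1\gamma)\tau_t^2l_t)\|G_x^{\tau_t}(x_t,y_t)\|^2+\sigma_t\|G_y^{\sigma_t}(x_t,y_t)\|^2+\sigma_t^2\frac{\mu_t}2\|G_y^{\sigma_t}(\tilde x_{t+1},y_t)\|^2\le\Lambda_t+4(3l_t-2\mu_t)\Delta_t+\mathcal L(x_t,y_t)-\mathcal L(\tilde x_{t+1},\tilde y_{t+1})+R_t$; (ii) $f(\tilde x_{t+1},y_t)+\langle\nabla_yf(\tilde x_{t+1},y_t),\tilde y_{t+1}-y_t\rangle\le f(\tilde x_{t+1},\tilde y_{t+1})+\frac{l_t}2\|\tilde y_{t+1}-y_t\|^2$; (iii) $\|\nabla_yf(\tilde x_{t+1},\tilde y_{t+1})-\nabla_yf(\tilde x_{t+1},y_t)\|\le l_t\|\tilde y_{t+1}-y_t\|$; (iv) $\|G_y^{\sigma_t}(\tilde x_{t+1},y_t)\|^2\le2\big(\frac{4(1-\sigma_t\mu_t)}{\sigma_t^2}+2l_t^2\big)\Delta_t+2l_t^2\tau_t^2\|G_x^{\tau_t}(x_t,y_t)\|^2$. *)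

(* Defs.v *)
From HB Require Import structures.
From mathcomp Require Import all_boot all_order all_algebra.
From mathcomp Require Import all_classical all_reals all_analysis.
Set Implicit Arguments.
Unset Strict Implicit.
Unset Printing Implicit Defensive.
Import Order.TTheory GRing.Theory Num.Theory.
Import numFieldNormedType.Exports.
Local Open Scope classical_set_scope.
Local Open Scope ring_scope.

(* The library norm on 'rV[R]_n is the sup norm; it is used below only through
   the topology and the differential, which do not depend on the norm.  All
   metric quantities use the Euclidean norm enorm. *)
Definition dotv (R : realType) (n : nat) (u v : 'rV[R]_n) : R :=
  \sum_(i < n) u 0 i * v 0 i.

Definition enorm (R : realType) (n : nat) (u : 'rV[R]_n) : R :=
  Num.sqrt (dotv u u).

Definition enorm2 (R : realType) (m n : nat) (u : 'rV[R]_m) (v : 'rV[R]_n) : R :=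
  Num.sqrt (enorm u ^+ 2 + enorm v ^+ 2).

Definition logb (R : realType) (b x : R) : R := ln x / ln b.

Definition edom (R : realType) (n : nat) (r : 'rV[R]_n -> \bar R)
  : set 'rV[R]_n := [set x | (r x < +oo)%E].

Definition proper (R : realType) (n : nat) (r : 'rV[R]_n -> \bar R) : Prop :=
  (forall x, r x != -oo%E) /\ edom r !=set0.

Definition econvex (R : realType) (n : nat) (r : 'rV[R]_n -> \bar R) : Prop :=
  forall (x y : 'rV[R]_n) (a : R), 0 < a -> a < 1 ->
    (r (a *: x + (1 - a) *: y)%R
       <= a%:E * r x + (1 - a)%:E * r y)%E.

Definition proper_closed_convex (R : realType) (n : nat)
    (r : 'rV[R]_n -> \bar R) : Prop :=
  [/\ proper r, lower_semicontinuous r & econvex r].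

Definition strongly_concave_on (R : realType) (n : nat) (A : set 'rV[R]_n)
    (mu : R) (phi : 'rV[R]_n -> R) : Prop :=
  forall (y z : 'rV[R]_n) (a : R), A y -> A z -> 0 <= a -> a <= 1 ->
    a * phi y + (1 - a) * phi z + mu / 2 * (a * (1 - a)) * enorm (y - z) ^+ 2
      <= phi (a *: y + (1 - a) *: z).

(* The argmin is unique for proper closed convex r; 0 is a default value when
   the set of minimizers is empty. *)
Definition prox (R : realType) (n : nat) (r : 'rV[R]_n -> \bar R)
    (x : 'rV[R]_n) : 'rV[R]_n :=
  xget 0 [set w | forall v,
    (r w + (enorm (w - x)%R ^+ 2 / 2)%:E <= r v + (enorm (v - x)%R ^+ 2 / 2)%:E)%E].

Definition escale (R : realType) (n : nat) (a : R) (r : 'rV[R]_n -> \bar R)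
  : 'rV[R]_n -> \bar R := fun w => (a%:E * r w)%E.

Definition ediam (R : realType) (n : nat) (A : set 'rV[R]_n) : \bar R :=
  ereal_sup [set (enorm (p.1 - p.2))%:E | p in A `*` A].

Record saddle (R : realType) (m n : nat) := Saddle {
  sg : 'rV[R]_m -> \bar R;
  sf : 'rV[R]_m * 'rV[R]_n -> R;
  sh : 'rV[R]_n -> \bar R }.

Section Saddle.
Context (R : realType) (m n : nat) (P : saddle R m n).

Definition Lag (x : 'rV[R]_m) (y : 'rV[R]_n) : \bar R :=
  (sg P x + (sf P (x, y))%:E - sh P y)%E.

Definition grad_x (x : 'rV[R]_m) (y : 'rV[R]_n) : 'rV[R]_m :=
  \row_(i < m) 'd (sf P) (x, y) (delta_mx 0 i, 0).

Definition grad_y (x : 'rV[R]_m) (y : 'rV[R]_n) : 'rV[R]_n :=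
  \row_(j < n) 'd (sf P) (x, y) (0, delta_mx 0 j).

Definition assumption_SC (L mu : R) : Prop :=
  [/\ proper_closed_convex (sg P) /\ proper_closed_convex (sh P),
      exists U : set ('rV[R]_m * 'rV[R]_n),
        [/\ open U, edom (sg P) `*` edom (sh P) `<=` U
          & forall p, U p -> differentiable (sf P) p],
      0 <= L /\ forall x x' y y',
        edom (sg P) x -> edom (sg P) x' -> edom (sh P) y -> edom (sh P) y' ->
        enorm2 (grad_x x y - grad_x x' y') (grad_y x y - grad_y x' y')
          <= L * enorm2 (x - x') (y - y')
    & 0 < mu /\ forall x, edom (sg P) x ->
        strongly_concave_on (edom (sh P)) mu (fun y => sf P (x, y))].

Definition x_plus (tau : R) (x : 'rV[R]_m) (y : 'rV[R]_n) : 'rV[R]_m :=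
  prox (escale tau (sg P)) (x - tau *: grad_x x y).

Definition y_plus (sigma : R) (x : 'rV[R]_m) (y : 'rV[R]_n) : 'rV[R]_n :=
  prox (escale sigma (sh P)) (y + sigma *: grad_y x y).

Definition Gx (tau : R) (x : 'rV[R]_m) (y : 'rV[R]_n) : 'rV[R]_m :=
  tau^-1 *: (x - x_plus tau x y).

Definition Gy (sigma : R) (x : 'rV[R]_m) (y : 'rV[R]_n) : 'rV[R]_n :=
  sigma^-1 *: (y_plus sigma x y - y).

End Saddle.

Record agda_input (R : realType) (m n : nat) := AgdaInput {
  in_x0 : 'rV[R]_m;
  in_y0 : 'rV[R]_n;
  in_zeta : R;
  in_mu : R;
  in_l : R;
  in_gamma0 : R;
  in_gamma : R;
  in_r : nat;
  in_max_solver : bool;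
  in_mu_known : bool;
  in_D_known : bool }.

Definition valid_input (R : realType) (m n : nat) (P : saddle R m n) (mu : R)
    (I : agda_input R m n) : Prop :=
  [/\ edom (sg P) (in_x0 I) /\ edom (sh P) (in_y0 I),
      [/\ 0 < in_zeta I, 0 < in_mu I & in_mu I < in_l I],
      0 < in_gamma0 I < 1 /\ 0 < in_gamma I < 1,
      (0 < in_r I)%N
    & in_mu_known I -> in_mu I = mu].

Inductive agda_pc := AtStep1 | AtStep2.

(* st_lo is the value of l_t on entry to iteration t; the algorithm records it
   but never reads it back. *)
Record agda_state (R : realType) (m n : nat) := AgdaState {
  st_pc : agda_pc;
  st_t : nat;
  st_x : 'rV[R]_m;
  st_y : 'rV[R]_n;
  st_l : R;
  st_lo : R;
  st_L : R;
  st_mu : R;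
  st_d : R;
  st_Delta : R;
  st_Lambda : R;
  st_R : R;
  st_flag : bool }.

Section Agda.
Context (R : realType) (m n : nat) (P : saddle R m n) (mu : R)
  (I : agda_input R m n).
Implicit Types s : agda_state R m n.

Definition gamma1 : R := in_gamma I ^+ in_r I.
Definition gamma2 : R := in_gamma I.
Definition mu_low : R := if in_mu_known I then mu else 0.
Definition D_bar : \bar R :=
  if in_D_known I && (ediam (edom (sh P)) < +oo)%E
  then ediam (edom (sh P)) else +oo%E.

(* d, Delta, Lambda and R are always assigned before being read; 0 is a
   placeholder. *)
Definition agda_init : agda_state R m n :=
  {| st_pc := AtStep1; st_t := 0; st_x := in_x0 I; st_y := in_y0 I;
     st_l := in_l I; st_lo := in_l I; st_L := in_l I; st_mu := in_mu I;
     st_d := 0; st_Delta := 0; st_Lambda := 0; st_R := 0; st_flag := false |}.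

Definition sigma_ s : R := (st_l s)^-1.

Definition tau_ s : R :=
  let sm := sigma_ s * st_mu s in
  (1 - in_gamma0 I) / st_l s *
  (4 + gamma2^-1 +
   4 * (1 - sm) * (2 - sm) * (15 * st_L s - 8 * st_mu s) * st_L s ^+ 3
     / st_mu s ^+ 4)^-1.

Definition xt s : 'rV[R]_m := x_plus P (tau_ s) (st_x s) (st_y s).
Definition yt s : 'rV[R]_n := y_plus P (sigma_ s) (xt s) (st_y s).

Definition Gx_t s : 'rV[R]_m := Gx P (tau_ s) (st_x s) (st_y s).
Definition Gy_t s : 'rV[R]_n := Gy P (sigma_ s) (st_x s) (st_y s).
Definition Gy_tilde s : 'rV[R]_n := Gy P (sigma_ s) (xt s) (st_y s).

Definition near_max (x : 'rV[R]_m) (y : 'rV[R]_n) : Prop :=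
  (ereal_sup (range (Lag P x)) <= Lag P x y + (in_zeta I)%:E)%E.

Definition leave_step1 s (y : 'rV[R]_n) (d : R) : agda_state R m n :=
  {| st_pc := AtStep2; st_t := st_t s; st_x := st_x s; st_y := y;
     st_l := st_l s; st_lo := st_lo s; st_L := st_L s; st_mu := st_mu s;
     st_d := d; st_Delta := st_Delta s; st_Lambda := st_Lambda s;
     st_R := st_R s; st_flag := true |}.

Definition do_step1 s s' : Prop :=
  if in_max_solver I then
    if st_flag s then s' = leave_step1 s (st_y s) (st_d s)
    else exists y, near_max (st_x s) y /\ s' = leave_step1 s y (st_d s)
  else
    let yhat := y_plus P (st_L s)^-1 (st_x s) (st_y s) in
    s' = leave_step1 s yhat (enorm (yhat - st_y s)).

(* The minimum is taken in the extended reals because D_bar may be +oo; it is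
   finite because its first argument is. *)
Definition do_step2b s : agda_state R m n :=
  if st_flag s then
    let e := enorm (st_y s - yt s) in
    {| st_pc := st_pc s; st_t := st_t s; st_x := st_x s; st_y := st_y s;
       st_l := st_l s; st_lo := st_lo s; st_L := st_L s; st_mu := st_mu s;
       st_d := st_d s;
       st_Delta :=
         if in_max_solver I then 2 * in_zeta I / st_mu s
         else fine (mine ((1 + 2 * st_L s / st_mu s) ^+ 2 * st_d s ^+ 2)%:E
                         (D_bar * D_bar)%E);
       st_Lambda :=
         if in_max_solver I then
           in_zeta I + Num.sqrt (2 * in_zeta I / st_mu s) * st_L s * e
         else 2 * st_d s * st_L s * e;
       st_R := 0; st_flag := st_flag s |}
  else s.

(* At the points involved Lag is finite, so fine loses nothing. *)
Definition BC s : Prop :=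
  let l := st_l s in let mut := st_mu s in
  let tau := tau_ s in let sigma := sigma_ s in
  let x := st_x s in let y := st_y s in
  [/\ (tau - (2 + (in_gamma I)^-1) * tau ^+ 2 * l) * enorm (Gx_t s) ^+ 2
        + sigma * enorm (Gy_t s) ^+ 2
        + sigma ^+ 2 * (mut / 2) * enorm (Gy_tilde s) ^+ 2
      <= st_Lambda s + 4 * (3 * l - 2 * mut) * st_Delta s
        + fine (Lag P x y) - fine (Lag P (xt s) (yt s)) + st_R s,
      sf P (xt s, y) + dotv (grad_y P (xt s) y) (yt s - y)
        <= sf P (xt s, yt s) + l / 2 * enorm (yt s - y) ^+ 2,
      enorm (grad_y P (xt s) (yt s) - grad_y P (xt s) y)
        <= l * enorm (yt s - y)
    & enorm (Gy_tilde s) ^+ 2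
        <= 2 * (4 * (1 - sigma * mut) / sigma ^+ 2 + 2 * l ^+ 2) * st_Delta s
          + 2 * l ^+ 2 * tau ^+ 2 * enorm (Gx_t s) ^+ 2].

Definition accept s : agda_state R m n :=
  let l' := Num.max (gamma2 * st_l s) (in_l I) in
  let sm := sigma_ s * st_mu s in
  let C := (1 - sm) * (2 - sm) / sm * (st_L s ^+ 2 / st_mu s ^+ 2)
             * tau_ s ^+ 2 in
  let Delta' := (1 - st_mu s * sigma_ s / 2) * st_Delta s
                  + C * enorm (Gx_t s) ^+ 2 in
  {| st_pc := AtStep2; st_t := (st_t s).+1; st_x := xt s; st_y := yt s;
     st_l := l'; st_lo := l'; st_L := st_L s; st_mu := st_mu s;
     st_d := st_d s;
     st_Delta := Delta';
     st_Lambda := 6 * st_l s * (Delta' + 2 * st_Delta s)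
                    - 8 * st_mu s * st_Delta s;
     st_R := 2 * tau_ s ^+ 2 * st_l s * enorm (Gx_t s) ^+ 2
               - sigma_ s ^+ 2 * st_mu s * enorm (Gy_tilde s) ^+ 2;
     st_flag := false |}.

Definition reject s : agda_state R m n :=
  {| st_pc := AtStep2; st_t := st_t s; st_x := st_x s; st_y := st_y s;
     st_l := st_l s / gamma2; st_lo := st_lo s; st_L := st_L s;
     st_mu := st_mu s; st_d := st_d s; st_Delta := st_Delta s;
     st_Lambda := st_Lambda s; st_R := st_R s; st_flag := st_flag s |}.

Definition do_step2 s : agda_state R m n :=
  let s1 := do_step2b s in if `[< BC s1 >] then accept s1 else reject s1.

Definition do_step3 s : agda_state R m n :=
  {| st_pc := AtStep1; st_t := st_t s; st_x := st_x s; st_y := st_y s;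
     st_l := st_l s; st_lo := st_lo s; st_L := st_L s / gamma1;
     st_mu := Num.max (st_mu s * gamma1) mu_low; st_d := st_d s;
     st_Delta := st_Delta s; st_Lambda := st_Lambda s; st_R := st_R s;
     st_flag := st_flag s |}.

Definition checks_BC s : Prop := st_pc s = AtStep2 /\ st_l s <= st_L s.

Definition updates_L_mu s : Prop := st_pc s = AtStep2 /\ st_L s < st_l s.

Definition agda_step s s' : Prop :=
  match st_pc s with
  | AtStep1 => do_step1 s s'
  | AtStep2 => s' = if st_l s <= st_L s then do_step2 s else do_step3 s
  end.

(* Only the choice made by the maximization oracle in step 1 is
   nondeterministic; the algorithm has no stopping rule, so runs are infinite. *)
Definition agda_run (s : nat -> agda_state R m n) : Prop :=
  s 0%N = agda_init /\ forall k, agda_step (s k) (s k.+1).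

(* Numbers of occurrences along a run, a priori possibly +oo. *)
Definition nb_updates (s : nat -> agda_state R m n) : \bar R :=
  counting [set k | updates_L_mu (s k)].

Definition nb_checks (s : nat -> agda_state R m n) (t : nat) : \bar R :=
  counting [set k | checks_BC (s k) /\ st_t (s k) = t].

Definition avg_checks (s : nat -> agda_state R m n) (T : nat) : \bar R :=
  ((T.+1%:R^-1)%:E * \sum_(t < T.+1) nb_checks s t)%E.

End Agda.

Definition calR (R : realType) (m n : nat) (I : agda_input R m n) (L mu : R) : R :=
  Num.max (in_mu I / mu) (Num.max (L / in_l I) 1).

(* Main.v *)
Require Import Defs.
From HB Require Import structures.
From mathcomp Require Import all_boot all_order all_algebra.
From mathcomp Require Import all_classical all_reals all_analysis.
From mathcomp Require Import finmap zify ring lra.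
Set Implicit Arguments.
Unset Strict Implicit.
Unset Printing Implicit Defensive.
Import Order.TTheory GRing.Theory Num.Theory.
Import numFieldNormedType.Exports.
Local Open Scope classical_set_scope.
Local Open Scope ring_scope.

(* Call a state good when L <= L_t and mu_t <= mu.  At a good state the test BC
   succeeds as soon as L <= l_t: Delta_t bounds the squared distance from y_t to
   the maximizer of Lag(x_t, .), so the prox-gradient step in y moves by
   O(sqrt Delta_t), and the increase of Lag(x_t, .) along the y step is paid for
   by Lambda_t + R_t, both when these were just reinitialised and when they were
   carried over from an accepted step.  Since l_t and L_t lie on the grid
   l~ * gamma^(-j) with L_t on the coarser grid l~ * gamma^(-rk), a rejection at
   exponent j forces gamma^(-j) < calR, and an update of (L_t, mu_t) forces
   gamma^(-rk) < calR.  Rejections raise the exponent of l_t by one and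
   acceptances lower it by at most one, so that the number of checks made so far
   is at most 2 t plus the current exponent. *)

(** * Euclidean geometry *)

(** The obstacle is that a run may accept steps at states that are not good, where the tests say
    nothing reliable about [Delta]. Hence [certified] promises the bounds of [after_accept] only
    under goodness. This suffices because L_t and mu_t change only in step (3), which leads back to
    step (1) and raises the flag: bounds carried over by accepted steps always stem from steps made
    with the current L_t and mu_t.

    Both origins of [Delta] and [Lambda] are treated by one inequality with a parameter k, equal to
    0 after a reinitialisation and to the accepted l otherwise. In the second case the y step costs
    an extra k/2 times its squared length; the surplus 6 k [Delta] in [Lambda] and the summand
    1/gamma of test (i) pay for it, the latter because k <= l_t / gamma.

    A rejection at a good state gives l_t < L strictly, so the exponents involved are strictly below
    the logarithm of [calR]; this strictness is what yields the ceiling and the constant 2 without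
    loss. *)

Section Euclidean.
Context (R : realType) (n : nat).
Implicit Types (u v w : 'rV[R]_n) (a : R).

Lemma dotvC u v : dotv u v = dotv v u.
Proof. by apply: eq_bigr => i _; rewrite mulrC. Qed.

Lemma dotvDl u v w : dotv (u + v) w = dotv u w + dotv v w.
Proof. by rewrite -big_split; apply: eq_bigr => i _; rewrite mxE mulrDl. Qed.

Lemma dotvZl a u v : dotv (a *: u) v = a * dotv u v.
Proof. by rewrite mulr_sumr; apply: eq_bigr => i _; rewrite mxE mulrA. Qed.

Lemma dotvNl u v : dotv (- u) v = - dotv u v.
Proof. by rewrite -scaleN1r dotvZl mulN1r. Qed.

Lemma dotvDr u v w : dotv u (v + w) = dotv u v + dotv u w.
Proof. by rewrite dotvC dotvDl !(dotvC u). Qed.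

Lemma dotvZr a u v : dotv u (a *: v) = a * dotv u v.
Proof. by rewrite dotvC dotvZl dotvC. Qed.

Lemma dotvNr u v : dotv u (- v) = - dotv u v.
Proof. by rewrite dotvC dotvNl dotvC. Qed.

Definition dotvE := (dotvDl, dotvDr, dotvNl, dotvNr, dotvZl, dotvZr).

Lemma dotv0 u : dotv u 0 = 0.
Proof. by rewrite -(scale0r u) dotvZr mul0r. Qed.

Lemma enorm0 : enorm (0 : 'rV[R]_n) = 0.
Proof. by rewrite /enorm dotv0 sqrtr0. Qed.

Lemma dotv_ge0 u : 0 <= dotv u u.
Proof. by apply: sumr_ge0 => i _; rewrite -expr2 sqr_ge0. Qed.

Lemma sqr_enorm u : enorm u ^+ 2 = dotv u u.
Proof. by rewrite sqr_sqrtr ?dotv_ge0. Qed.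

Lemma enorm_ge0 u : 0 <= enorm u.
Proof. exact: sqrtr_ge0. Qed.

Lemma enormN u : enorm (- u) = enorm u.
Proof. by rewrite /enorm dotvNl dotvNr opprK. Qed.

Lemma enormB u v : enorm (u - v) = enorm (v - u).
Proof. by rewrite -enormN opprB. Qed.

Lemma enormZ a u : enorm (a *: u) = `|a| * enorm u.
Proof.
by rewrite /enorm dotvZl dotvZr mulrA -expr2 sqrtrM ?sqr_ge0// sqrtr_sqr.
Qed.

Lemma coord_le_enorm u i : `|u 0 i| <= enorm u.
Proof.
rewrite -sqrtr_sqr ler_sqrt ?dotv_ge0// /dotv (bigD1 i)//= expr2 lerDl.
by apply: sumr_ge0 => j _; rewrite -expr2 sqr_ge0.
Qed.

Lemma enorm_eq0 u : enorm u = 0 -> u = 0.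
Proof.
move=> u0; apply/rowP => i; rewrite mxE; apply/eqP; rewrite -normr_le0.
by rewrite -u0 coord_le_enorm.
Qed.

Lemma dotv_le u v : dotv u v <= enorm u * enorm v.
Proof.
have [v0|vn0] := eqVneq (enorm v) 0.
  by rewrite v0 mulr0 (enorm_eq0 v0) dotv0.
have v0 : 0 < enorm v ^+ 2 by rewrite exprn_gt0// lt_neqAle eq_sym vn0 enorm_ge0.
have H := dotv_ge0 (enorm v ^+ 2 *: u - dotv u v *: v).
apply: (@le_trans _ _ (Num.sqrt (dotv u v ^+ 2))).
  by rewrite sqrtr_sqr ler_norm.
rewrite -[leRHS]ger0_norm ?mulr_ge0 ?enorm_ge0// -sqrtr_sqr ler_sqrt ?sqr_ge0//.
rewrite exprMn.
rewrite !dotvE (dotvC v u) -!sqr_enorm in H.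
rewrite -(ler_pM2l v0); move: H; lra.
Qed.

Lemma normr_dotv_le u v : `|dotv u v| <= enorm u * enorm v.
Proof. by rewrite ler_norml lerNl -dotvNl dotv_le -(enormN u) dotv_le. Qed.

Lemma enormD u v : enorm (u + v) <= enorm u + enorm v.
Proof.
rewrite -(ler_pXn2r (ltn0Sn 1)) ?nnegrE ?addr_ge0 ?enorm_ge0//.
rewrite sqr_enorm !dotvE -!sqr_enorm (dotvC v u).
have := dotv_le u v; lra.
Qed.

Lemma enorm_triangle w u v : enorm (u - v) <= enorm (u - w) + enorm (w - v).
Proof. by rewrite (le_trans _ (enormD _ _))// addrA subrK. Qed.

Lemma sqr_enormD_le u v : enorm (u + v) ^+ 2 <= 2 * enorm u ^+ 2 + 2 * enorm v ^+ 2.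
Proof.
have := dotv_ge0 (u - v); rewrite !sqr_enorm !dotvE (dotvC v u); lra.
Qed.

Lemma enorm_continuous u : continuous (fun w => enorm (w - u)).
Proof.
have H (i : 'I_n) : continuous (fun w : 'rV[R]_n => (w - u) 0 i).
  rewrite (_ : (fun w => _) = (fun w : 'rV[R]_n => w 0 i - u 0 i)); last first.
    by apply/funext => z; rewrite !mxE.
  move=> w; apply: (@continuousB _ R _ (fun w : 'rV[R]_n => w 0 i) (cst (u 0 i))).
    exact: coord_continuous.
  exact: cst_continuous.
move=> w; apply: (@continuous_comp _ _ _
  (fun w => \sum_(i < n) (w - u) 0 i * (w - u) 0 i) Num.sqrt); last first.
  exact: sqrt_continuous.
apply: continuous_big => [|i _ z]; first exact: add_continuous.
by apply: (@continuousM R _ (fun w : 'rV[R]_n => (w - u) 0 i)); exact: H.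
Qed.

(** The ambient norm is the sup norm, so boundedness is read off the coordinates, which [enorm]
    dominates. *)
Lemma compact_eball u (D : R) : compact [set w | enorm (w - u) <= D].
Proof.
apply: bounded_closed_compact; last first.
  apply: (@preimage_closed _ _ (fun w : 'rV[R]_n => enorm (w - u)) [set x | x <= D]).
    by move=> w _; exact: enorm_continuous.
  exact: closed_le.
exists (D + enorm u); split; first by rewrite num_real.
move=> M DM w /= wD.
have w0 : enorm w <= D + enorm u.
  by rewrite -[w](subrK u) (le_trans (enormD _ _))// lerD2r.
have M0 : 0 <= M by apply: le_trans (ltW DM); rewrite (le_trans (enorm_ge0 _) w0).
rewrite [leLHS]/Num.Def.normr/= mx_normrE; apply: bigmax_le => // -[i j] _ /=.
by rewrite ord1 (le_trans (coord_le_enorm _ _))// (le_trans w0)// ltW.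
Qed.

End Euclidean.

(* Passage to the limit [a -> 0+] of a first-order condition along a segment. *)
Lemma le_of_segment (R : realType) (X Y Z : R) :
  (forall a, 0 < a -> a < 1 -> X <= Y + a * Z) -> X <= Y.
Proof.
move=> H; apply/ler_addgt0Pr => e e0.
have Z0 : 0 < `|Z| + e + 1 by rewrite ltr_wpDl// addr_ge0// ltW.
have a0 : 0 < e / (`|Z| + e + 1) by rewrite divr_gt0.
apply: (le_trans (H _ a0 _)).
  by rewrite ltr_pdivrMr// mul1r; have := normr_ge0 Z; lra.
rewrite lerD2l mulrAC ler_pdivrMr// ler_wpM2l ?ltW//.
by have := ler_norm Z; lra.
Qed.

(** * Proximal points *)

Section StronglyConvexMin.
Context (R : realType) (n : nat) (A : set 'rV[R]_n) (F : 'rV[R]_n -> R) (c : R).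

(* Lower semicontinuity and strong convexity of [F] on [A], extended by [+oo]. *)
Definition lsc_on : Prop := forall p a, (A p -> a < F p) ->
  nbhs p [set y | A y -> a < F y].

Definition scvx_on : Prop := forall y z a, A y -> A z -> 0 < a -> a < 1 ->
  A (a *: y + (1 - a) *: z) /\
  F (a *: y + (1 - a) *: z) + c / 2 * (a * (1 - a)) * enorm (y - z) ^+ 2
    <= a * F y + (1 - a) * F z.

(** The minimizer is a cluster point of the filter generated by the sublevel sets. If such a point
    were outside [A], or had a value above some [F v], lower semicontinuity would give it a
    neighbourhood missing the sublevel set of [v]. *)
Lemma lsc_min_compact (K : set 'rV[R]_n) : lsc_on -> compact K ->
  (exists v, A v /\ K v) ->
  exists2 p, A p /\ K p & forall v, A v -> K v -> F p <= F v.
Proof.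
move=> lF cK [v0 [Av0 Kv0]].
pose B v := [set w | [/\ A w, K w & F w <= F v]].
pose D := [set v | A v /\ K v].
have FF : ProperFilter (filter_from D B).
  apply: filter_from_proper => [|v [Av Kv]]; last by exists v.
  apply: filter_from_filter; first by exists v0.
  move=> u v Du Dv; have [uv|vu] := leP (F u) (F v).
    by exists u => // w [Aw Kw wu]; split; split => //; apply: le_trans uv.
  by exists v => // w [Aw Kw wu]; split; split => //; apply: le_trans (ltW vu).
have [|p [Kp clp]] := cK (filter_from D B) FF.
  by exists v0 => // w [].
have key v : A v -> K v -> A p /\ F p <= F v.
  move=> Av Kv; apply: contrapT => N.
  have Np : A p -> F v < F p.
    by move=> Ap; rewrite ltNge; apply/negP => Fpv; apply: N.
  have FB : filter_from D B (B v) by exists v.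
  have [w [[Aw Kw wv] /(_ Aw)]] := clp _ _ FB (lF _ _ Np).
  by rewrite ltNge wv.
by exists p => [|v Av Kv]; [have [] := key _ Av0 Kv0|have [] := key _ Av Kv].
Qed.

(** Coercivity is derived: a lower bound on the unit ball around [x0], applied where the segment
    from [x0] to a far [v] leaves that ball, forces quadratic growth of [F]. *)
Lemma scvx_min : lsc_on -> 0 < c -> scvx_on -> A !=set0 ->
  exists2 p, A p & forall v, A v -> F p <= F v.
Proof.
move=> lF c0 sF [x0 Ax0].
have K0 D : 0 <= D -> A x0 /\ enorm (x0 - x0) <= D.
  by move=> D0; rewrite subrr enorm0.
have [q [Aq qB] qmin] := lsc_min_compact lF (@compact_eball _ _ x0 1)
  (ex_intro _ x0 (K0 _ ler01)).
have qx0 : F q <= F x0 by have [_ ?] := K0 _ ler01; exact: qmin.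
(* Chosen so that c/2 times (D - 1) equals F x0 - F q: beyond this radius strong convexity gives F
   x0 <= F v. *)
pose D := 1 + 2 * (F x0 - F q) / c.
have D1 : 1 <= D by rewrite lerDl divr_ge0 ?(ltW c0)// mulr_ge0// subr_ge0.
have Dge0 : 0 <= D by lra.
have [p [Ap pB] pmin] := lsc_min_compact lF (@compact_eball _ _ x0 D)
  (ex_intro _ x0 (K0 _ Dge0)).
exists p => // v Av.
have [vD|Dv] := leP (enorm (v - x0)) D; first exact: pmin.
have [_ x0D] := K0 _ Dge0.
apply: (le_trans (pmin _ Ax0 x0D)).
set d := enorm (v - x0) in Dv.
have d0 : 0 < d by lra.
have d1 : 0 < d^-1 by rewrite invr_gt0.
have d2 : d^-1 < 1 by rewrite invf_lt1//; lra.
have [Az] := sF v x0 _ Av Ax0 d1 d2.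
set z := (X in F X); move=> zle.
have zB : enorm (z - x0) <= 1.
  rewrite /z (_ : _ - _ = d^-1 *: (v - x0)); last first.
    by rewrite scalerBl scalerBr scale1r addrAC addrA subrK.
  by rewrite enormZ gtr0_norm// mulVf// gt_eqF.
have qz := qmin _ Az zB; rewrite -/d in zle.
have E : d * (F z + c / 2 * (d^-1 * (1 - d^-1)) * d ^+ 2)
  <= F v + (d - 1) * F x0.
  apply: le_trans (ler_wpM2l (ltW d0) zle) _.
  rewrite le_eqVlt; apply/orP; left; apply/eqP; field; lra.
have E2 : d * (F z + c / 2 * (d^-1 * (1 - d^-1)) * d ^+ 2) =
  d * F z + d * (c / 2 * (d - 1)) by field; lra.
rewrite E2 in E.
have cD : F x0 - F q <= c / 2 * (d - 1).
  have -> : F x0 - F q = c / 2 * (D - 1) by rewrite /D; field; lra.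
  by rewrite ler_wpM2l// ?lerD2r ?(ltW Dv)//; lra.
have E3 : d * (F x0 - F q) <= d * (c / 2 * (d - 1)) by rewrite ler_wpM2l// ltW.
have E4 : d * F q <= d * F z by rewrite ler_wpM2l// ltW.
by move: E E3 E4; clear; lra.
Qed.

Lemma scvx_min_growth p : scvx_on -> A p -> (forall v, A v -> F p <= F v) ->
  forall v, A v -> F p + c / 2 * enorm (v - p) ^+ 2 <= F v.
Proof.
move=> sF Ap pmin v Av.
apply: (@le_of_segment _ _ _ (c / 2 * enorm (v - p) ^+ 2)) => a a0 a1.
have [Aw H] := sF v p a Av Ap a0 a1.
have := pmin _ Aw => Hp.
rewrite -subr_ge0 -(pmulr_rge0 _ a0); move: H Hp; clear; lra.
Qed.

End StronglyConvexMin.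

(** At a point outside [A], [lsc_on] says that [F] tends to +oo along [A], so a local lower bound of
    [G] is enough there. *)
Lemma lsc_onD (R : realType) (n : nat) (A : set 'rV[R]_n) (F G : 'rV[R]_n -> R) :
  (forall p : 'rV[R]_n, exists b, nbhs p [set y | A y -> b <= G y]) ->
  (forall (p : 'rV[R]_n) a, A p -> a < G p -> nbhs p [set y | A y -> a < G y]) ->
  lsc_on A F -> lsc_on A (fun y => F y + G y).
Proof.
move=> Gb Gc lF p a ap; have [Ap|NAp] := pselect (A p).
  have e0 : 0 < (F p + G p - a) / 2 by have := ap Ap; lra.
  set e := _ / 2 in e0.
  have H1 := @lF p (F p - e) (fun=> ltac:(lra)).
  have H2 := Gc p (G p - e) Ap ltac:(lra).
  apply: filterS2 H1 H2 => y /= h1 h2 Ay.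
  by have := h1 Ay; have := h2 Ay; rewrite /e; lra.
have [b bP] := Gb p.
have H1 := @lF p (a - b) (fun Ap => False_ind _ (NAp Ap)).
apply: filterS2 H1 bP => y /= h1 h2 Ay.
by have := h1 Ay; have := h2 Ay; lra.
Qed.

Section Prox.
Context (R : realType) (n : nat) (r : 'rV[R]_n -> \bar R).
Hypothesis pcc : proper_closed_convex r.

Lemma edomE v : edom r v -> r v = (fine (r v))%:E.
Proof.
move=> rv; rewrite fineK// fin_numE; case: pcc => -[-> _] _ _ /=.
by rewrite lt_eqF.
Qed.

Lemma notin_edomE v : ~ edom r v -> r v = +oo%E.
Proof.
by rewrite /edom/=; case: pcc => -[/(_ v) + _] _ _; case: (r v) => //= x _ []; rewrite ltry.
Qed.

Lemma edom_convex y z a : edom r y -> edom r z -> 0 < a -> a < 1 ->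
  edom r (a *: y + (1 - a) *: z) /\
  fine (r (a *: y + (1 - a) *: z)) <= a * fine (r y) + (1 - a) * fine (r z).
Proof.
move=> ry rz a0 a1; case: (pcc) => _ _ /(_ y z a a0 a1).
rewrite {1}(edomE ry) {1}(edomE rz) -!EFinM -EFinD => H.
have D : edom r (a *: y + (1 - a) *: z) by apply: le_lt_trans H _; rewrite ltry.
by split=> //; move: H; rewrite (edomE D) lee_fin.
Qed.

Lemma edom_lsc : lsc_on (edom r) (fun v => fine (r v)).
Proof.
move=> p a ap; case: pcc => _ /(_ p a) + _ => H.
have /H[V pV VP] : (a%:E < r p)%E.
  have [rp|Nrp] := pselect (edom r p); first by rewrite edomE// lte_fin ap.
  by rewrite notin_edomE// ltry.
by apply: filterS pV => y /VP + ry; rewrite edomE// lte_fin.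
Qed.

(** Half the squared distance is 1-strongly convex with equality. *)
Lemma half_sqr_dist_combination (x y z : 'rV[R]_n) (a : R) :
  enorm (a *: y + (1 - a) *: z - x) ^+ 2 / 2 + 1 / 2 * (a * (1 - a)) * enorm (y - z) ^+ 2
  = a * (enorm (y - x) ^+ 2 / 2) + (1 - a) * (enorm (z - x) ^+ 2 / 2).
Proof.
by rewrite !sqr_enorm !dotvE (dotvC z y) (dotvC x y) (dotvC x z); lra.
Qed.

(** [prox] is chosen by [xget], so existence of a minimizer has to be shown first, to exclude the
    default value; it comes from 1-strong convexity of the objective. *)
Lemma prox_min a x : 0 < a -> edom r (prox (escale a r) x) /\
  forall v, edom r v ->
    a * fine (r (prox (escale a r) x)) + enorm (prox (escale a r) x - x) ^+ 2 / 2
    <= a * fine (r v) + enorm (v - x) ^+ 2 / 2.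
Proof.
move=> a0.
have escaleE v : edom r v -> (escale a r v + (enorm (v - x) ^+ 2 / 2)%:E)%E =
    (a * fine (r v) + enorm (v - x) ^+ 2 / 2)%:E.
  by move=> rv; rewrite /escale edomE.
have escaleN v : ~ edom r v ->
    (escale a r v + (enorm (v - x) ^+ 2 / 2)%:E)%E = +oo%E.
  by move=> rv; rewrite /escale notin_edomE// gt0_muley.
have cont : continuous (fun v : 'rV[R]_n => enorm (v - x) ^+ 2 / 2).
  move=> v; apply: (@continuousM R _ (fun v : 'rV[R]_n => enorm (v - x) ^+ 2));
    last exact: cst_continuous.
  apply: (@continuous_comp _ _ _ (fun v : 'rV[R]_n => enorm (v - x)) (fun t => t ^+ 2)).
    exact: enorm_continuous.
  exact: exprn_continuous.
have cont_gt (q : 'rV[R]_n) b : b < enorm (q - x) ^+ 2 / 2 ->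
    \forall y \near q, b < enorm (y - x) ^+ 2 / 2.
  by move=> bq; exact: cvgr_gt _ (cont q) _ bq.
have [v0 v0r] : edom r !=set0 by case: pcc => -[].
have [p pr pmin] : exists2 p, edom r p & forall v, edom r v ->
    a * fine (r p) + enorm (p - x) ^+ 2 / 2
    <= a * fine (r v) + enorm (v - x) ^+ 2 / 2.
  apply: (@scvx_min _ _ _ (fun v => a * fine (r v) + enorm (v - x) ^+ 2 / 2) 1) => //.
  - apply: lsc_onD.
    + move=> q; exists 0; apply: filterS filterT => y _ _.
      by rewrite mulr_ge0// ?sqr_ge0.
    + move=> q b _ bq; by apply: filterS (cont_gt _ _ bq) => y + _.
    + move=> q b bq; have H := @edom_lsc q (b / a).
      apply: filterS (H _) => [y /= h ry|rq].
        by have := h ry; rewrite ltr_pdivrMr// mulrC.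
      by rewrite ltr_pdivrMr// mulrC bq.
  - move=> y z s ry rz s0 s1; have [D H] := edom_convex ry rz s0 s1.
    split=> //; have := half_sqr_dist_combination x y z s.
    have := ler_wpM2l (ltW a0) H; lra.
  - by exists v0.
set S := [set w | forall v, (escale a r w + (enorm (w - x)%R ^+ 2 / 2)%:E
    <= escale a r v + (enorm (v - x)%R ^+ 2 / 2)%:E)%E].
have S0 : S !=set0.
  exists p => v; have [rv|Nrv] := pselect (edom r v).
    by rewrite !escaleE// lee_fin pmin.
  by rewrite (escaleN v)// leey.
have wS : S (prox (escale a r) x) by exact: xgetPex.
have wr : edom r (prox (escale a r) x).
  apply: contrapT => N; have := wS v0.
  by rewrite escaleN// escaleE.
by split=> // v rv; have := wS v; rewrite !escaleE// lee_fin.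
Qed.

Lemma edom_prox a x : 0 < a -> edom r (prox (escale a r) x).
Proof. by move=> a0; case: (prox_min x a0). Qed.

(** The inclusion of (x - w)/a in the subdifferential of [r] at the proximal point w, obtained by
    comparing w with points of the segment towards [v]. *)
Lemma prox_le a x v : 0 < a -> edom r v ->
  fine (r (prox (escale a r) x))
    + a^-1 * dotv (x - prox (escale a r) x) (v - prox (escale a r) x)
  <= fine (r v).
Proof.
move=> a0 rv; have [] := prox_min x a0; set w := prox _ x => rw wmin.
suff H : a * fine (r w) + dotv (x - w) (v - w) <= a * fine (r v).
  by rewrite -(ler_pM2l a0) mulrDr mulrA divff ?gt_eqF// mul1r.
apply: (@le_of_segment _ _ _ (enorm (v - w) ^+ 2 / 2)) => s s0 s1.
have [ru H] := edom_convex rv rw s0 s1.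
have := wmin _ ru; have := half_sqr_dist_combination x v w s.
have := ler_wpM2l (ltW a0) H.
have : enorm (v - x) ^+ 2 = enorm (v - w) ^+ 2 - 2 * dotv (x - w) (v - w) + enorm (w - x) ^+ 2.
  by rewrite !sqr_enorm !dotvE (dotvC v x) (dotvC w x) (dotvC w v); lra.
move=> -> H1 H2 H3; rewrite -(ler_pM2l s0); move: H1 H2 H3; clear; lra.
Qed.

End Prox.

(** * Smoothness and strong concavity of the coupling *)

(** Stands in for integrating the derivative: the mean value theorem is applied to phi(t) - K t^2 /
    2, whose derivative is at most a. *)
Lemma increment_le (R : realType) (phi dphi : R -> R) (a K : R) :
  (forall t : R, 0 <= t -> t <= 1 -> is_derive t 1 phi (dphi t)) ->
  (forall t, 0 <= t -> t <= 1 -> dphi t <= a + K * t) ->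
  phi 1 - phi 0 <= a + K / 2.
Proof.
move=> dp le.
pose psi t := phi t - (K / 2 * t ^+ 2).
have dpsi (t : R) : 0 <= t -> t <= 1 -> is_derive t 1 psi (dphi t - K * t).
  move=> t0 t1; have D := dp t t0 t1.
  have D2 : is_derive t 1 (K / 2 \*: (@id R) ^+ 2) (K * t).
    by apply: is_derive_eq; rewrite /GRing.scale/=; field.
  exact: is_deriveB D D2.
have [| |c] := @MVT R psi (fun t => dphi t - K * t) 0 1 ltr01.
- by move=> t; rewrite in_itv/= => /andP[t0 t1]; apply: dpsi; rewrite ltW.
- apply: derivable_within_continuous => t; rewrite in_itv/= => /andP[t0 t1].
  by have [] := dpsi t t0 t1.
- rewrite in_itv/= => /andP[c0 c1].
  have := le c (ltW c0) (ltW c1); rewrite /psi; lra.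
Qed.

Section Smooth.
Context (R : realType) (m n : nat) (P : saddle R m n) (L mu : R).
Hypothesis SC : assumption_SC P L mu.
Implicit Types (x u : 'rV[R]_m) (y w : 'rV[R]_n).
Local Notation Dg := (edom (sg P)).
Local Notation Dh := (edom (sh P)).
Local Notation f := (sf P).

Let pccg : proper_closed_convex (sg P). Proof. by case: SC => -[]. Qed.
Let pcch : proper_closed_convex (sh P). Proof. by case: SC => -[]. Qed.

Lemma SC_mu_gt0 : 0 < mu. Proof. by case: SC => _ _ _ []. Qed.

Lemma SC_L_ge0 : 0 <= L. Proof. by case: SC => _ _ [] ? _ _. Qed.

Lemma sf_differentiable x y : Dg x -> Dh y -> differentiable f (x, y).
Proof. by move=> gx hy; case: SC => _ [U [_ sub dU]] _ _; apply/dU/sub. Qed.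

Lemma diff_sfE x y u w : Dg x -> Dh y ->
  'd f (x, y) (u, w) = dotv (grad_x P x y) u + dotv (grad_y P x y) w.
Proof.
move=> gx hy.
have -> : (u, w) = \sum_(i < m) u 0 i *: (delta_mx 0 i, 0 : 'rV[R]_n)
    + \sum_(j < n) w 0 j *: (0 : 'rV[R]_m, delta_mx 0 j).
  have -> : \sum_(i < m) u 0 i *: (delta_mx 0 i, 0 : 'rV[R]_n) = (u, 0).
    rewrite {2}(row_sum_delta u); elim/big_rec2: _ => // i a b _ ->.
    by rewrite /GRing.scale/= /GRing.add/= /scale_pair/= /add_pair/= scaler0 add0r.
  have -> : \sum_(j < n) w 0 j *: (0 : 'rV[R]_m, delta_mx 0 j) = (0, w).
    rewrite {2}(row_sum_delta w); elim/big_rec2: _ => // i a b _ ->.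
    by rewrite /GRing.scale/= /GRing.add/= /scale_pair/= /add_pair/= scaler0 add0r.
  by rewrite /GRing.add/= /add_pair/= addr0 add0r.
rewrite linearD !linear_sum; congr (_ + _).
  by apply: eq_bigr => i _; rewrite linearZ mxE mulrC.
by apply: eq_bigr => i _; rewrite linearZ mxE mulrC.
Qed.

Lemma is_derive_path x y u w (t : R) : Dg (x + t *: u) -> Dh (y + t *: w) ->
  is_derive t 1 (fun s => f (x + s *: u, y + s *: w))
    (dotv (grad_x P (x + t *: u) (y + t *: w)) u
     + dotv (grad_y P (x + t *: u) (y + t *: w)) w).
Proof.
move=> gx hy; have D := sf_differentiable gx hy.
rewrite -diff_sfE// -deriveE//.
have E : (fun h : R => h^-1 *: (f (x + (h *: 1 + t) *: u, y + (h *: 1 + t) *: w)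
      - f (x + t *: u, y + t *: w))) =
    (fun h : R => h^-1 *: (f (h *: (u, w) + (x + t *: u, y + t *: w))
      - f (x + t *: u, y + t *: w))).
  apply/funext => h; congr (_ *: (f _ - _)); congr pair => /=.
    by rewrite [h *: 1]mulr1 scalerDl addrCA.
  by rewrite [h *: 1]mulr1 scalerDl addrCA.
split.
  rewrite /derivable; under eq_fun do rewrite /=.
  rewrite E; exact: diff_derivable.
by rewrite /derive E.
Qed.

Lemma is_derive_path_x x y u (t : R) : Dg (x + t *: u) -> Dh y ->
  is_derive t 1 (fun s => f (x + s *: u, y)) (dotv (grad_x P (x + t *: u) y) u).
Proof.
move=> gx hy; have hy0 : Dh (y + t *: 0) by rewrite scaler0 addr0.
have := is_derive_path gx hy0.
rewrite (_ : (fun s => _) = (fun s => f (x + s *: u, y))).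
  by rewrite scaler0 addr0 dotv0 addr0.
by apply/funext => s; rewrite scaler0 addr0.
Qed.

Lemma is_derive_path_y x y w (t : R) : Dg x -> Dh (y + t *: w) ->
  is_derive t 1 (fun s => f (x, y + s *: w)) (dotv (grad_y P x (y + t *: w)) w).
Proof.
move=> gx hy; have gx0 : Dg (x + t *: 0) by rewrite scaler0 addr0.
have := is_derive_path gx0 hy.
rewrite (_ : (fun s => _) = (fun s => f (x, y + s *: w))).
  by rewrite scaler0 addr0 dotv0 add0r.
by apply/funext => s; rewrite scaler0 addr0.
Qed.

Lemma edom_segment k (r : 'rV[R]_k -> \bar R) (y z : 'rV[R]_k) (t : R) :
  proper_closed_convex r -> edom r y -> edom r z -> 0 <= t -> t <= 1 ->
  edom r (y + t *: (z - y)).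
Proof.
move=> pcc ry rz; rewrite le_eqVlt => /predU1P[<- _|t0].
  by rewrite scale0r addr0.
rewrite le_eqVlt => /predU1P[->|t1]; first by rewrite scale1r addrC subrK.
have [] := edom_convex pcc rz ry t0 t1.
by rewrite scalerBl scale1r scalerBr addrCA addrC -addrA [- _ + _]addrC.
Qed.

Lemma grad_lipschitz x x' y y' : Dg x -> Dg x' -> Dh y -> Dh y' ->
  enorm2 (grad_x P x y - grad_x P x' y') (grad_y P x y - grad_y P x' y')
    <= L * enorm2 (x - x') (y - y').
Proof. by case: SC => _ _ [_ H] _; exact: H. Qed.

Lemma enorm_le_enorm2l j k (u : 'rV[R]_j) (w : 'rV[R]_k) : enorm u <= enorm2 u w.
Proof.
rewrite -[leLHS]ger0_norm ?enorm_ge0// -sqrtr_sqr ler_sqrt ?lerDl ?sqr_ge0//.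
by rewrite addr_ge0// sqr_ge0.
Qed.

Lemma enorm2C j k (u : 'rV[R]_j) (w : 'rV[R]_k) : enorm2 u w = enorm2 w u.
Proof. by rewrite /enorm2 addrC. Qed.

Lemma enorm2_0r j k (u : 'rV[R]_j) : enorm2 u (0 : 'rV[R]_k) = enorm u.
Proof.
rewrite /enorm2 enorm0 expr0n addr0.
by rewrite sqrtr_sqr ger0_norm// enorm_ge0.
Qed.

Lemma grad_x_lipschitz_x x x' y : Dg x -> Dg x' -> Dh y ->
  enorm (grad_x P x y - grad_x P x' y) <= L * enorm (x - x').
Proof.
move=> gx gx' hy; apply: le_trans (enorm_le_enorm2l _ (grad_y P x y - grad_y P x' y)) _.
by apply: le_trans (grad_lipschitz gx gx' hy hy) _; rewrite subrr enorm2_0r.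
Qed.

Lemma grad_y_lipschitz_x x x' y : Dg x -> Dg x' -> Dh y ->
  enorm (grad_y P x y - grad_y P x' y) <= L * enorm (x - x').
Proof.
move=> gx gx' hy; apply: le_trans (enorm_le_enorm2l _ (grad_x P x y - grad_x P x' y)) _.
rewrite enorm2C.
by apply: le_trans (grad_lipschitz gx gx' hy hy) _; rewrite subrr enorm2_0r.
Qed.

Lemma grad_y_lipschitz_y x y y' : Dg x -> Dh y -> Dh y' ->
  enorm (grad_y P x y - grad_y P x y') <= L * enorm (y - y').
Proof.
move=> gx hy hy'; apply: le_trans (enorm_le_enorm2l _ (grad_x P x y - grad_x P x y')) _.
rewrite enorm2C; apply: le_trans (grad_lipschitz gx gx hy hy') _.
by rewrite subrr enorm2C enorm2_0r.
Qed.

Lemma dotv_lipschitz k (v v' w d : 'rV[R]_k) t :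
  enorm (v - v') <= L * enorm d -> enorm d = t * enorm w ->
  dotv v w <= dotv v' w + L * enorm w ^+ 2 * t /\
  - dotv v w <= - dotv v' w + L * enorm w ^+ 2 * t.
Proof.
move=> + dE; rewrite dE => vL.
have := normr_dotv_le (v - v') w; rewrite dotvDl dotvNl ler_norml => /andP[].
have := ler_wpM2r (enorm_ge0 w) vL; split; lra.
Qed.

Lemma descent_x x x' y : Dg x -> Dg x' -> Dh y ->
  f (x', y) <= f (x, y) + dotv (grad_x P x y) (x' - x) + L / 2 * enorm (x' - x) ^+ 2.
Proof.
move=> gx gx' hy.
have seg t : 0 <= t -> t <= 1 -> Dg (x + t *: (x' - x)).
  exact: edom_segment.
have := @increment_le R (fun t => f (x + t *: (x' - x), y))
  (fun t => dotv (grad_x P (x + t *: (x' - x)) y) (x' - x))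
  (dotv (grad_x P x y) (x' - x)) (L * enorm (x' - x) ^+ 2).
rewrite scale1r scale0r addr0 [x + _]addrC subrK => H.
suff: f (x', y) - f (x, y) <= dotv (grad_x P x y) (x' - x) + L * enorm (x' - x) ^+ 2 / 2.
  by lra.
apply: H => t t0 t1; first by apply: is_derive_path_x => //; exact: seg.
apply: (dotv_lipschitz (grad_x_lipschitz_x (seg t t0 t1) gx hy) _).1.
by rewrite addrAC subrr add0r enormZ ger0_norm.
Qed.

End Smooth.

(** * Concavity in y and best responses *)

Section Saddle.
Context (R : realType) (m n : nat) (P : saddle R m n) (L mu : R).
Hypothesis SC : assumption_SC P L mu.
Implicit Types (x u : 'rV[R]_m) (y w : 'rV[R]_n).
Local Notation Dg := (edom (sg P)).
Local Notation Dh := (edom (sh P)).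
Local Notation f := (sf P).

Let pcch : proper_closed_convex (sh P). Proof. by case: SC => -[]. Qed.
Let mu0 : 0 < mu := SC_mu_gt0 SC.

Let seg_h y y' t : Dh y -> Dh y' -> 0 <= t -> t <= 1 -> Dh (y + t *: (y' - y)).
Proof. exact: edom_segment. Qed.

Lemma ascent_y x y y' : Dg x -> Dh y -> Dh y' ->
  f (x, y') <= f (x, y) + dotv (grad_y P x y) (y' - y) + L / 2 * enorm (y' - y) ^+ 2.
Proof.
move=> gx hy hy'.
have := @increment_le R (fun t => f (x, y + t *: (y' - y)))
  (fun t => dotv (grad_y P x (y + t *: (y' - y))) (y' - y))
  (dotv (grad_y P x y) (y' - y)) (L * enorm (y' - y) ^+ 2).
rewrite scale1r scale0r addr0 [y + _]addrC subrK => H.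
suff: f (x, y') - f (x, y) <= dotv (grad_y P x y) (y' - y) + L * enorm (y' - y) ^+ 2 / 2.
  by lra.
apply: H => t t0 t1.
  by apply: (is_derive_path_y SC) => //; exact: seg_h.
apply: (dotv_lipschitz (grad_y_lipschitz_y SC gx (seg_h hy hy' t0 t1) hy) _).1.
by rewrite addrAC subrr add0r enormZ ger0_norm.
Qed.

Lemma descent_y x y y' : Dg x -> Dh y -> Dh y' ->
  f (x, y) + dotv (grad_y P x y) (y' - y) <= f (x, y') + L / 2 * enorm (y' - y) ^+ 2.
Proof.
move=> gx hy hy'.
have := @increment_le R (fun t => - f (x, y + t *: (y' - y)))
  (fun t => - dotv (grad_y P x (y + t *: (y' - y))) (y' - y))
  (- dotv (grad_y P x y) (y' - y)) (L * enorm (y' - y) ^+ 2).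
rewrite scale1r scale0r addr0 [y + _]addrC subrK => H.
suff: - f (x, y') - - f (x, y)
  <= - dotv (grad_y P x y) (y' - y) + L * enorm (y' - y) ^+ 2 / 2 by lra.
apply: H => t t0 t1.
  by apply: is_deriveN; apply: (is_derive_path_y SC) => //; exact: seg_h.
apply: (dotv_lipschitz (grad_y_lipschitz_y SC gx (seg_h hy hy' t0 t1) hy) _).2.
by rewrite addrAC subrr add0r enormZ ger0_norm.
Qed.

(** Strong concavity at y + t (y' - y), bounded above by [ascent_y] and divided by t, leaves an
    error t (L + mu)/2 times the squared distance, which vanishes as t tends to 0. *)
Lemma concave_y x y y' : Dg x -> Dh y -> Dh y' ->
  f (x, y') <= f (x, y) + dotv (grad_y P x y) (y' - y) - mu / 2 * enorm (y' - y) ^+ 2.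
Proof.
move=> gx hy hy'; case: (SC) => _ _ _ [_ /(_ x gx) sc].
suff H : f (x, y') - f (x, y) + mu / 2 * enorm (y' - y) ^+ 2 <= dotv (grad_y P x y) (y' - y).
  by move: H; lra.
apply: (@le_of_segment _ _ _ ((L + mu) / 2 * enorm (y' - y) ^+ 2)) => t t0 t1.
have E : t *: y' + (1 - t) *: y = y + t *: (y' - y).
  by rewrite scalerBl scale1r scalerBr addrCA addrC -addrA [- _ + _]addrC.
have S := sc y' y t hy' hy (ltW t0) (ltW t1); rewrite E in S.
have := ascent_y gx hy (seg_h hy hy' (ltW t0) (ltW t1)).
rewrite [y + _ - y]addrAC subrr add0r dotvZr enormZ exprMn gtr0_norm// => A.
rewrite -(ler_pM2l t0); move: S A; clear; lra.
Qed.

(** Along the segment from y to y' the derivative of the difference is a change of [grad_y] caused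
    by x alone. This keeps the coupling of the x and y moves bilinear. *)
Lemma mixed_difference_le x x' y y' : Dg x -> Dg x' -> Dh y -> Dh y' ->
  f (x', y') - f (x, y') - (f (x', y) - f (x, y))
    <= L * enorm (x' - x) * enorm (y' - y).
Proof.
move=> gx gx' hy hy'.
have := @increment_le R (fun t => f (x', y + t *: (y' - y)) - f (x, y + t *: (y' - y)))
  (fun t => dotv (grad_y P x' (y + t *: (y' - y))) (y' - y)
    - dotv (grad_y P x (y + t *: (y' - y))) (y' - y))
  (L * enorm (x' - x) * enorm (y' - y)) 0.
rewrite mul0r addr0 scale1r scale0r addr0 [y + _]addrC subrK; apply=> t t0 t1.
  by apply: is_deriveB; apply: (is_derive_path_y SC) => //; exact: seg_h.
rewrite mul0r addr0 -dotvNl -dotvDl; apply: (le_trans (dotv_le _ _)).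
by rewrite ler_wpM2r ?enorm_ge0// (grad_y_lipschitz_x SC)//; exact: seg_h.
Qed.

(* The real-valued restriction of [- Lag P x] to [dom h], up to [g x]. *)
Definition dual_loss x y : R := fine (sh P y) - f (x, y).

Lemma dual_loss_scvx x : Dg x -> scvx_on Dh (dual_loss x) mu.
Proof.
move=> gx y z a hy hz a0 a1; case: (SC) => _ _ _ [_ /(_ x gx) sc].
have [D H] := edom_convex pcch hy hz a0 a1.
have := sc y z a hy hz (ltW a0) (ltW a1).
by split=> //; rewrite /dual_loss; lra.
Qed.

Lemma sf_continuous_y x y : Dg x -> Dh y -> {for y, continuous (fun y => f (x, y))}.
Proof.
move=> gx hy; apply: (@continuous_comp _ _ _ (fun y => (x, y)) f).
  exact: (@cvg_pair _ _ _ (nbhs y) (nbhs x) (nbhs y) _ _ _ (cst x) id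
    (cvg_cst x) cvg_id).
exact/differentiable_continuous/(sf_differentiable SC).
Qed.

Lemma dual_loss_lsc x : Dg x -> lsc_on Dh (dual_loss x).
Proof.
move=> gx; apply: lsc_onD; last exact: edom_lsc.
- move=> p; have [y0 hy0] : Dh !=set0 by case: pcch => -[].
  (* The point p may lie outside [dom h], where f is uncontrolled; on [dom h] concavity keeps f
     below its tangent at a fixed y0. *)
  exists (- (f (x, y0) + enorm (grad_y P x y0) * (enorm (p - y0) + 1))).
  have near1 : \forall y \near p, enorm (y - y0) < enorm (p - y0) + 1.
    by apply: (cvgr_lt _ (@enorm_continuous _ _ y0 p)); rewrite ltrDl.
  apply: filterS near1 => y yp hy; rewrite lerN2.
  have := concave_y gx hy0 hy.
  have := dotv_le (grad_y P x y0) (y - y0).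
  have := ler_wpM2l (enorm_ge0 (grad_y P x y0)) (ltW yp).
  have := mulr_ge0 (ltW mu0) (sqr_ge0 (enorm (y - y0))); lra.
- move=> p a hp ap.
  have near1 : \forall y \near p, f (x, y) < - a.
    by apply: (cvgr_lt _ (sf_continuous_y gx hp)); rewrite ltrNr.
  by apply: filterS near1 => y + _; rewrite ltrNr.
Qed.

(** Encoded by quadratic growth around the maximizer of [Lag P x], the form in which it is always
    used. *)
Definition is_best_response x p : Prop :=
  Dh p /\ forall v, Dh v -> dual_loss x p + mu / 2 * enorm (v - p) ^+ 2 <= dual_loss x v.

Lemma best_response_ex x : Dg x -> exists p, is_best_response x p.
Proof.
move=> gx; have sF := dual_loss_scvx gx.
have [|p hp pmin] := scvx_min (dual_loss_lsc gx) mu0 sF; first by case: pcch => -[].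
by exists p; split => //; exact: scvx_min_growth.
Qed.

(** Each growth inequality is tested at the other best response; their sum bounds mu times the
    squared distance by the mixed difference of f. *)
Lemma best_response_lipschitz x x' p p' : Dg x -> Dg x' ->
  is_best_response x p -> is_best_response x' p' ->
  mu * enorm (p' - p) <= L * enorm (x' - x).
Proof.
move=> gx gx' [hp pm] [hp' pm'].
have [->|N0] := eqVneq (enorm (p' - p)) 0.
  by rewrite mulr0 mulr_ge0 ?enorm_ge0// (SC_L_ge0 SC).
have e0 : 0 < enorm (p' - p) by rewrite lt_neqAle eq_sym N0 enorm_ge0.
rewrite -(ler_pM2r e0); have := mixed_difference_le gx gx' hp hp'.
have := pm _ hp'; have := pm' _ hp; rewrite /dual_loss enormB.
set d := enorm (p' - p); clear; lra.
Qed.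

End Saddle.

(** * Proximal gradient steps in x and y *)

Section ProxSteps.
Context (R : realType) (m n : nat) (P : saddle R m n) (L mu : R).
Hypothesis SC : assumption_SC P L mu.
Implicit Types (x u p : 'rV[R]_m) (y w v q : 'rV[R]_n).
Local Notation Dg := (edom (sg P)).
Local Notation Dh := (edom (sh P)).
Local Notation f := (sf P).

Let pccg : proper_closed_convex (sg P). Proof. by case: SC => -[]. Qed.
Let pcch : proper_closed_convex (sh P). Proof. by case: SC => -[]. Qed.
Let mu0 : 0 < mu := SC_mu_gt0 SC.

Lemma edom_x_plus t x y : 0 < t -> Dg (x_plus P t x y).
Proof. exact: edom_prox. Qed.

Lemma edom_y_plus t x y : 0 < t -> Dh (y_plus P t x y).
Proof. exact: edom_prox. Qed.

Lemma x_plus_le t x y u : 0 < t -> Dg u ->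
  fine (sg P (x_plus P t x y))
    + t^-1 * dotv (x - x_plus P t x y) (u - x_plus P t x y)
    - dotv (grad_x P x y) (u - x_plus P t x y) <= fine (sg P u).
Proof.
move=> t0 gu; have := prox_le pccg (x - t *: grad_x P x y) t0 gu.
rewrite -/(x_plus P t x y); set z := x_plus P t x y.
rewrite (addrAC x _ (- z)) (dotvDl (x - z)) (dotvNl (t *: _)) dotvZl.
rewrite mulrDr mulrN mulrA mulVf ?gt_eqF//.
by rewrite mul1r addrA.
Qed.

Lemma y_plus_le l x y v : 0 < l -> Dh v ->
  fine (sh P (y_plus P l^-1 x y))
    + l * dotv (y - y_plus P l^-1 x y) (v - y_plus P l^-1 x y)
    + dotv (grad_y P x y) (v - y_plus P l^-1 x y) <= fine (sh P v).
Proof.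
move=> l0 hv; have l'0 : 0 < l^-1 by rewrite invr_gt0.
have := prox_le pcch (y + l^-1 *: grad_y P x y) l'0 hv.
rewrite -/(y_plus P l^-1 x y); set z := y_plus P l^-1 x y.
rewrite (addrAC y _ (- z)) (dotvDl (y - z)) dotvZl invrK mulrDr mulrA mulfV ?gt_eqF//.
by rewrite mul1r addrA.
Qed.

(** The descent inequality is a hypothesis at the one point concerned, so that it can come either
    from L <= l or from test (ii) of an accepted step. *)
Lemma y_plus_contraction l x y q : 0 < l -> Dg x -> Dh y ->
  f (x, y) + dotv (grad_y P x y) (y_plus P l^-1 x y - y)
    <= f (x, y_plus P l^-1 x y) + l / 2 * enorm (y_plus P l^-1 x y - y) ^+ 2 ->
  is_best_response P mu x q ->
  l * enorm (y_plus P l^-1 x y - q) ^+ 2 <= (l - mu) * enorm (y - q) ^+ 2.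
Proof.
move=> l0 gx hy + [hq qmin].
have hz := edom_y_plus x y (t := l^-1) ltac:(by rewrite invr_gt0).
have := y_plus_le x y l0 hq.
move: hz; set z := y_plus P l^-1 x y => hz.
have := qmin _ hz; have := concave_y SC gx hy hq.
have := mulr_ge0 (ltW mu0) (sqr_ge0 (enorm (z - q))).
have -> : z - y = (q - y) - (q - z).
  by rewrite opprB [RHS]addrC addrA subrK.
rewrite (enormB y q).
have -> : y - z = (q - z) - (q - y) by rewrite opprB [RHS]addrC addrA subrK.
rewrite (enormB z q) /dual_loss.
move: (q - z) (q - y) => a b; rewrite !sqr_enorm !dotvE (dotvC b a); lra.
Qed.

(** Nonexpansiveness of the proximal map: the two optimality inequalities, each tested at the other
    point, are added. *)
Lemma y_plus_lipschitz l x x' y : 0 < l -> Dg x -> Dg x' -> Dh y ->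
  l * enorm (y_plus P l^-1 x' y - y_plus P l^-1 x y) <= L * enorm (x' - x).
Proof.
move=> l0 gx gx' hy.
have l'0 : 0 < l^-1 by rewrite invr_gt0.
have hz := edom_y_plus x y l'0; have hz' := edom_y_plus x' y l'0.
have := grad_y_lipschitz_x SC gx' gx hy.
have := y_plus_le x y l0 hz'; have := y_plus_le x' y l0 hz.
move: (y_plus P l^-1 x y) (y_plus P l^-1 x' y) => z z'.
move: (grad_y P x y) (grad_y P x' y) => d d' H1 H2 dd'.
have [->|N0] := eqVneq (enorm (z' - z)) 0.
  by rewrite mulr0 mulr_ge0 ?enorm_ge0// (SC_L_ge0 SC).
have e0 : 0 < enorm (z' - z) by rewrite lt_neqAle eq_sym N0 enorm_ge0.
rewrite -(ler_pM2r e0) -mulrA -expr2 sqr_enorm.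
have H3 := dotv_le (d' - d) (z' - z).
have H4 := ler_wpM2r (enorm_ge0 (z' - z)) dd'.
move: H1 H2 (le_trans H3 H4).
rewrite !dotvE (dotvC z' z); lra.
Qed.

(** The left argument of [dotv] is the subgradient of h given by the proximal step, minus the
    gradient of f at the new point. *)
Lemma dual_loss_subgradient l x y v : 0 < l -> Dg x -> Dh y -> Dh v ->
  dual_loss P x (y_plus P l^-1 x y)
    + dotv (l *: (y - y_plus P l^-1 x y)
            + (grad_y P x y - grad_y P x (y_plus P l^-1 x y)))
        (v - y_plus P l^-1 x y)
    + mu / 2 * enorm (v - y_plus P l^-1 x y) ^+ 2
  <= dual_loss P x v.
Proof.
move=> l0 gx hy hv.
have hz := edom_y_plus x y (t := l^-1) ltac:(by rewrite invr_gt0).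
have := y_plus_le x y l0 hv; have := concave_y SC gx hz hv.
move: hz; move: (y_plus P l^-1 x y) => z hz.
move: (grad_y P x) => g; rewrite /dual_loss !dotvDl !dotvNl !dotvZl dotvDl dotvNl.
lra.
Qed.

End ProxSteps.

(** * The backtracking condition *)

Lemma sqr_le_2sqrD (R : realType) (a b c : R) :
  0 <= b -> b <= c + a -> b ^+ 2 <= 2 * c ^+ 2 + 2 * a ^+ 2.
Proof.
move=> b0 bca; have : b ^+ 2 <= (c + a) ^+ 2 by rewrite ler_pXn2r// nnegrE; lra.
by have := sqr_ge0 (c - a); lra.
Qed.

(** Here a, b, c are the lengths of the x step, of the y step from the new x and of the y step from
    the old x. The summand 2 collects L/2 and the 3/2 from a b <= 3/2 a^2 + c^2/2; the summand [ig]
    absorbs k a^2, and 6 k D covers the 4 k D left by k/2 b^2. *)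
Lemma backtracking_budget (R : realType) (L l mut D a b c k ig : R) :
  0 <= L -> L <= l -> 0 < mut -> mut < l -> 0 <= a -> 0 <= b -> b <= c + a ->
  0 <= D -> l * c ^+ 2 <= (4 * l - 2 * mut) * D -> 0 <= k -> k <= ig * l ->
  L / 2 * a ^+ 2 + L * a * b + l * c ^+ 2 + k / 2 * b ^+ 2
    <= (2 + ig) * l * a ^+ 2 + 4 * (3 * l - 2 * mut) * D + 6 * k * D.
Proof.
move=> L0 Ll m0 ml a0 b0 bca D0 cD k0 kl.
have l0 : 0 < l by lra.
have c2 : c ^+ 2 <= 4 * D.
  rewrite -(ler_pM2l l0); apply: le_trans cD _.
  by have := mulr_ge0 (ltW m0) D0; lra.
have b2 := sqr_le_2sqrD b0 bca.
have H1 : k / 2 * b ^+ 2 <= 4 * k * D + k * a ^+ 2.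
  have := ler_wpM2l k0 b2; have := ler_wpM2l k0 c2; lra.
have H2 : k * a ^+ 2 <= ig * l * a ^+ 2 by rewrite ler_wpM2r// sqr_ge0.
have H3 : L * a * b <= l * (3 / 2 * a ^+ 2 + c ^+ 2 / 2).
  apply: (@le_trans _ _ (l * (a * b))).
    by rewrite -mulrA ler_wpM2r// mulr_ge0.
  rewrite ler_wpM2l ?(ltW l0)//; apply: le_trans (ler_wpM2l a0 bca) _.
  by have := sqr_ge0 (c - a); lra.
have H4 : L / 2 * a ^+ 2 <= l / 2 * a ^+ 2 by rewrite ler_wpM2r ?sqr_ge0//; lra.
have H5 := mulr_ge0 k0 D0.
have H6 : mut * D <= l * D by rewrite ler_wpM2r// ltW.
have H7 := mulr_ge0 (ltW m0) D0.
move: H1 H2 H3 H4 H5 H6 H7 cD; clear; lra.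
Qed.

Section BacktrackingCondition.
Context (R : realType) (m n : nat) (P : saddle R m n) (L mu : R)
  (I : agda_input R m n).
Hypothesis SC : assumption_SC P L mu.
Local Notation Dg := (edom (sg P)).
Local Notation Dh := (edom (sh P)).
Local Notation f := (sf P).

Let pccg : proper_closed_convex (sg P). Proof. by case: SC => -[]. Qed.
Let pcch : proper_closed_convex (sh P). Proof. by case: SC => -[]. Qed.

Lemma fine_Lag x y : Dg x -> Dh y ->
  fine (Lag P x y) = fine (sg P x) + f (x, y) - fine (sh P y).
Proof. by move=> gx hy; rewrite /Lag (edomE pccg gx) (edomE pcch hy). Qed.

Lemma enorm_Gx t x y : 0 < t ->
  enorm (Gx P t x y) ^+ 2 = (enorm (x_plus P t x y - x) / t) ^+ 2.
Proof.
by move=> t0; rewrite enormZ gtr0_norm ?invr_gt0// enormB mulrC.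
Qed.

Lemma enorm_Gy l x y : 0 < l ->
  enorm (Gy P l^-1 x y) ^+ 2 = (l * enorm (y_plus P l^-1 x y - y)) ^+ 2.
Proof. by move=> l0; rewrite enormZ invrK gtr0_norm. Qed.

(* [k] is the stepsize parameter of the last accepted step, or [0] when
   [Delta] and [Lambda] were just reinitialised. *)
Lemma BC_of_certificate (s : agda_state R m n) q (k : R) :
  0 < in_gamma I -> Dg (st_x s) -> Dh (st_y s) -> 0 < tau_ I s ->
  L <= st_l s -> 0 < st_mu s -> st_mu s < st_l s -> st_mu s <= mu ->
  is_best_response P mu (st_x s) q ->
  enorm (st_y s - q) ^+ 2 <= st_Delta s ->
  0 <= k -> k <= st_l s / in_gamma I ->
  dual_loss P (st_x s) (st_y s) - dual_loss P (st_x s) (yt P I s)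
      + st_mu s / 2 * enorm (yt P I s - st_y s) ^+ 2 + 6 * k * st_Delta s
    <= st_Lambda s + st_R s + k / 2 * enorm (yt P I s - st_y s) ^+ 2 ->
  BC P I s.
Proof.
set x := st_x s; set y := st_y s; set l := st_l s; set mut := st_mu s.
set D := st_Delta s; set tau := tau_ I s.
move=> g0 gx hy tau0 Ll m0 ml mmu bq yq k0 kl cert.
have l0 : 0 < l by lra.
have l'0 : 0 < l^-1 by rewrite invr_gt0.
have gxt : Dg (xt P I s) by exact: (edom_x_plus SC).
have hyt : Dh (yt P I s) by exact: (edom_y_plus SC).
have hyo := edom_y_plus SC x y l'0.
have D0 : 0 <= D by exact: le_trans (sqr_ge0 _) yq.
have desc x' y' (gx' : Dg x') (hy' : Dh y') : f (x', y) + dotv (grad_y P x' y) (y' - y)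
    <= f (x', y') + l / 2 * enorm (y' - y) ^+ 2.
  apply: le_trans (descent_y SC gx' hy hy') _.
  by rewrite lerD2l ler_wpM2r ?sqr_ge0// ler_wpM2r.
have lip x' y' (gx' : Dg x') (hy' : Dh y') :
    enorm (grad_y P x' y' - grad_y P x' y) <= l * enorm (y' - y).
  apply: le_trans (grad_y_lipschitz_y SC gx' hy' hy) _.
  by rewrite ler_wpM2r ?enorm_ge0.
pose a := enorm (xt P I s - x); pose b := enorm (yt P I s - y).
pose c := enorm (y_plus P l^-1 x y - y).
have a0 : 0 <= a := enorm_ge0 _.
have b0 : 0 <= b := enorm_ge0 _.
(* The detour through q: c^2 is at most twice the squared distances to q after and before the step,
   and l times these are at most (l - mut) D and l D. *)
have cD : l * c ^+ 2 <= (4 * l - 2 * mut) * D.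
  have := y_plus_contraction SC l0 gx hy (desc _ _ gx hyo) bq.
  have := sqr_enormD_le (y_plus P l^-1 x y - q) (q - y).
  rewrite addrA subrK (enormB q) -/c => H1 H2.
  have := ler_wpM2l (ltW l0) H1.
  have H3 : (l - mu) * enorm (y - q) ^+ 2 <= (l - mut) * D.
    apply: (@le_trans _ _ ((l - mut) * enorm (y - q) ^+ 2)).
      by rewrite ler_wpM2r ?sqr_ge0//; lra.
    by rewrite ler_wpM2l//; lra.
  have := ler_wpM2l (ltW l0) yq.
  move: H2 H3; clear; lra.
have bca : b <= c + a.
  have := y_plus_lipschitz SC l0 gx gxt hy; rewrite -/a => H.
  apply: le_trans (enorm_triangle (y_plus P l^-1 x y) _ _) _.
  rewrite addrC lerD2l -(ler_pM2l l0); apply: le_trans H _.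
  by rewrite ler_wpM2r.
have b2 := sqr_le_2sqrD b0 bca.
have EGx : enorm (Gx_t P I s) ^+ 2 = (a / tau) ^+ 2 by exact: enorm_Gx.
have EGy : enorm (Gy_t P s) ^+ 2 = (l * c) ^+ 2 by exact: enorm_Gy.
have EGt : enorm (Gy_tilde P I s) ^+ 2 = (l * b) ^+ 2 by exact: enorm_Gy.
have tn0 : tau != 0 by rewrite gt_eqF.
have ln0 : l != 0 by rewrite gt_eqF.
split; last 3 first.
- exact: desc.
- exact: lip.
(* Test (iv) reduces to b^2 <= 2 c^2 + 2 a^2: by [cD], 2 l c^2 <= (8 l - 4 mut) D, which is at most
   (12 l - 8 mut) D since mut <= l. *)
- rewrite EGx EGt /sigma_ -/l -/mut -/D.
  have -> : 2 * l ^+ 2 * tau ^+ 2 * (a / tau) ^+ 2 = l * (l * (2 * a ^+ 2)) by field.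
  have -> : 2 * (4 * (1 - l^-1 * mut) / l^-1 ^+ 2 + 2 * l ^+ 2) * D
    = l * (12 * (l * D) - 8 * (mut * D)) by field.
  have -> : (l * b) ^+ 2 = l * (l * b ^+ 2) by ring.
  rewrite -mulrDr ler_wpM2l ?(ltW l0)//.
  have := ler_wpM2l (ltW l0) b2; have : mut * D <= l * D by rewrite ler_wpM2r// ltW.
  move: cD; clear; lra.
suff H gX gY gT lag lag' : gX = (a / tau) ^+ 2 -> gY = (l * c) ^+ 2 ->
    gT = (l * b) ^+ 2 ->
    lag = fine (sg P x) + f (x, y) - fine (sh P y) ->
    lag' = fine (sg P (xt P I s)) + f (xt P I s, yt P I s) - fine (sh P (yt P I s)) ->
    (tau - (2 + (in_gamma I)^-1) * tau ^+ 2 * l) * gX + l^-1 * gY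
      + l^-1 ^+ 2 * (mut / 2) * gT
    <= st_Lambda s + 4 * (3 * l - 2 * mut) * D + lag - lag' + st_R s.
  exact: H EGx EGy EGt (fine_Lag gx hy) (fine_Lag gxt hyt).
move=> -> -> -> -> ->.
have -> : (tau - (2 + (in_gamma I)^-1) * tau ^+ 2 * l) * (a / tau) ^+ 2
  = tau^-1 * a ^+ 2 - (2 + (in_gamma I)^-1) * l * a ^+ 2.
  by field; rewrite tn0 gt_eqF.
have -> : l^-1 * (l * c) ^+ 2 = l * c ^+ 2 by field.
have -> : l^-1 ^+ 2 * (mut / 2) * (l * b) ^+ 2 = mut / 2 * b ^+ 2 by field.
(* The change of [Lag] is split into the x move at fixed y, the y move at fixed x (paid by [cert])
   and the mixed difference, at most L a b. *)
have := backtracking_budget (SC_L_ge0 SC) Ll m0 ml a0 b0 bca D0 cD k0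
  (ig := (in_gamma I)^-1) ltac:(by rewrite mulrC).
have := x_plus_le SC x y tau0 gx.
rewrite -/(xt P I s) -sqr_enorm enormB -/a.
have := descent_x SC gx gxt hy; rewrite -/a.
have := mixed_difference_le SC gx gxt hy hyt; rewrite -/a -/b.
have -> : dotv (grad_x P x y) (x - xt P I s) = - dotv (grad_x P x y) (xt P I s - x).
  by rewrite -dotvNr opprB.
move: cert; rewrite /dual_loss -/b.
move: (dotv (grad_x P x y) _) => G; clear; lra.
Qed.

End BacktrackingCondition.

(** Young's inequality with the weight eps such that (1 - th)(1 + eps) = 1 - th/2; then (1 - th)(1 +
    1/eps) is the factor of g^2, whence the constant C_t of the algorithm. *)
Lemma geometric_drift (R : realType) (th e g : R) : 0 < th ->
  (1 - th) * (e + g) ^+ 2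
    <= (1 - th / 2) * e ^+ 2 + (1 - th) * (2 - th) / th * g ^+ 2.
Proof.
move=> t0; rewrite -subr_ge0.
have -> : (1 - th / 2) * e ^+ 2 + (1 - th) * (2 - th) / th * g ^+ 2
    - (1 - th) * (e + g) ^+ 2 = th / 2 * (e - 2 * (1 - th) * g / th) ^+ 2.
  by field; rewrite gt_eqF.
by rewrite mulr_ge0 ?sqr_ge0// divr_ge0// ltW.
Qed.

(** * Distance and ascent bounds for each way of producing y_t *)

Section Certificates.
Context (R : realType) (m n : nat) (P : saddle R m n) (L mu : R)
  (I : agda_input R m n).
Hypothesis SC : assumption_SC P L mu.
Local Notation Dg := (edom (sg P)).
Local Notation Dh := (edom (sh P)).
Local Notation f := (sf P).

Let pccg : proper_closed_convex (sg P). Proof. by case: SC => -[]. Qed.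
Let pcch : proper_closed_convex (sh P). Proof. by case: SC => -[]. Qed.

(** Outside [dom h] the value of [Lag P x] is -oo, which cannot be within [in_zeta I] of a supremum
    that some point of [dom h] makes larger than -oo. *)
Lemma near_max_dual_loss x y : Dg x -> near_max P I x y ->
  Dh y /\ forall v, Dh v -> dual_loss P x y <= dual_loss P x v + in_zeta I.
Proof.
move=> gx nm.
have LagE v : Dh v -> Lag P x v = (fine (sg P x) + f (x, v) - fine (sh P v))%:E.
  by move=> hv; rewrite /Lag (edomE pccg gx) (edomE pcch hv).
have up v : (Lag P x v <= Lag P x y + (in_zeta I)%:E)%E.
  by apply: le_trans nm; apply: ereal_sup_ubound; exists v.
have hy : Dh y.
  apply: contrapT => N; have [v hv] : Dh !=set0 by case: pcch => -[].
  by have := up v; rewrite LagE// /Lag (edomE pccg gx) (notin_edomE pcch N).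
split=> // v hv; have := up v; rewrite !LagE// -EFinD lee_fin /dual_loss; lra.
Qed.

(** Growth at q turns zeta-optimality into a distance bound. For the second part the growth at v is
    expanded around y, and the cross term is bounded by Cauchy-Schwarz and mut <= Lt. *)
Lemma near_max_certificate x y q : Dg x -> near_max P I x y ->
  is_best_response P mu x q -> forall mut, 0 < mut -> mut <= mu ->
  enorm (y - q) ^+ 2 <= 2 * in_zeta I / mut /\
  forall Lt v, Dh v -> mut <= Lt ->
    dual_loss P x y - dual_loss P x v + mut / 2 * enorm (v - y) ^+ 2
    <= in_zeta I + Num.sqrt (2 * in_zeta I / mut) * Lt * enorm (y - v).
Proof.
move=> gx nm [hq qmin] mut m0 mmu; have [hy ymax] := near_max_dual_loss gx nm.
have yq : enorm (y - q) ^+ 2 <= 2 * in_zeta I / mut.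
  rewrite ler_pdivlMr//; have := ymax _ hq; have := qmin _ hy.
  have : enorm (y - q) ^+ 2 * mut <= enorm (y - q) ^+ 2 * mu.
    by rewrite ler_wpM2l// sqr_ge0.
  lra.
split=> // Lt v hv mL; set rt := Num.sqrt _.
have e1 : enorm (y - q) <= rt.
  by rewrite -[leLHS]ger0_norm ?enorm_ge0// -sqrtr_sqr ler_wsqrtr.
have := ymax _ hq; have := qmin _ hv.
have H1 : mut / 2 * enorm (v - q) ^+ 2 <= mu / 2 * enorm (v - q) ^+ 2.
  by rewrite ler_wpM2r ?sqr_ge0//; lra.
have H2 : mut * (enorm (y - q) * enorm (v - y)) <= rt * Lt * enorm (y - v).
  rewrite (enormB y v) mulrA ler_wpM2r ?enorm_ge0// mulrC.
  by rewrite ler_pM ?enorm_ge0// ltW.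
have H3 : enorm (v - q) ^+ 2 = enorm (v - y) ^+ 2 + 2 * dotv (v - y) (y - q)
    + enorm (y - q) ^+ 2.
  have -> : v - q = (v - y) + (y - q) by rewrite addrA subrK.
  by move: (v - y) (y - q) => a b; rewrite !sqr_enorm !dotvE (dotvC b a); lra.
have H4 : - (enorm (y - q) * enorm (v - y)) <= dotv (v - y) (y - q).
  have := normr_dotv_le (v - y) (y - q); rewrite ler_norml mulrC => /andP[]//.
have H5 := ler_wpM2l (ltW m0) H4.
have H6 := mulr_ge0 (ltW m0) (sqr_ge0 (enorm (y - q))).
rewrite H3 in H1 *; move: H1 H2 H5 H6; clear; lra.
Qed.

(** The subgradient at y left by the proximal step has norm at most 2 Lt d: Lt d from the
    displacement and L d <= Lt d from the change of gradient. *)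
Lemma prox_certificate x y0 q Lt : Dg x -> Dh y0 -> 0 < Lt -> L <= Lt ->
  is_best_response P mu x q ->
  let y := y_plus P Lt^-1 x y0 in let d := enorm (y - y0) in
  mu * enorm (y - q) <= 2 * Lt * d /\
  forall v, Dh v ->
    dual_loss P x y - dual_loss P x v + mu / 2 * enorm (v - y) ^+ 2
    <= 2 * d * Lt * enorm (y - v).
Proof.
move=> gx hy0 Lt0 LLt [hq qmin] y d.
have hy : Dh y by apply: (edom_y_plus SC); rewrite invr_gt0.
set w := Lt *: (y0 - y) + (grad_y P x y0 - grad_y P x y).
have wd : enorm w <= 2 * Lt * d.
  apply: le_trans (enormD _ _) _; rewrite enormZ gtr0_norm// (enormB y0) -/d.
  have := grad_y_lipschitz_y SC gx hy0 hy; rewrite (enormB y0) -/d.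
  have : L * d <= Lt * d by rewrite ler_wpM2r// enorm_ge0.
  move: (enorm (grad_y P x y0 - _)) => e; clear; lra.
have sub v (hv : Dh v) : dual_loss P x y + dotv w (v - y)
    + mu / 2 * enorm (v - y) ^+ 2 <= dual_loss P x v.
  exact: (dual_loss_subgradient SC).
have lower v : - (2 * Lt * d * enorm (v - y)) <= dotv w (v - y).
  have := normr_dotv_le w (v - y); rewrite ler_norml => /andP[+ _].
  by apply: le_trans; rewrite lerN2 ler_wpM2r// enorm_ge0.
split=> [|v hv].
  have [->|N0] := eqVneq (enorm (y - q)) 0.
    by rewrite mulr0 !mulr_ge0 ?enorm_ge0// ltW.
  have e0 : 0 < enorm (y - q) by rewrite lt_neqAle eq_sym N0 enorm_ge0.
  rewrite -(ler_pM2r e0) -[mu * _ * _]mulrA -expr2.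
  have := sub _ hq; have := qmin _ hy; have := lower q; rewrite (enormB q).
  clear; lra.
have := sub _ hv; have := lower v; rewrite (enormB y v).
clear; lra.
Qed.

(* Strong concavity improves the bound [2 * lm * d] on the subgradient to
   [sqrt (2 * lm * (lm - mu)) * d]. *)
Lemma accepted_certificate x y0 lm v : Dg x -> Dh y0 -> 0 < lm ->
  let y := y_plus P lm^-1 x y0 in
  enorm (grad_y P x y - grad_y P x y0) <= lm * enorm (y - y0) -> Dh v ->
  dual_loss P x y - dual_loss P x v + mu / 2 * enorm (v - y) ^+ 2
    <= (lm - mu) * enorm (y - y0) ^+ 2 + lm / 2 * enorm (v - y) ^+ 2.
Proof.
move=> gx hy0 lm0 y lip hv.
have hy : Dh y by apply: (edom_y_plus SC); rewrite invr_gt0.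
have := dual_loss_subgradient SC lm0 gx hy0 hv; rewrite -/y.
have := concave_y SC gx hy0 hy; have := concave_y SC gx hy hy0.
move: lip hy; move: (y) => {}y lip hy; move: lip.
move: (grad_y P x) => g lip; rewrite (enormB y0 y).
rewrite -[y0 - y]opprB !dotvNr.
have H1 : enorm (g y0 - g y) ^+ 2 <= (lm * enorm (y - y0)) ^+ 2.
  by rewrite ler_pXn2r// ?nnegrE ?enorm_ge0// ?mulr_ge0 ?enorm_ge0 ?(ltW lm0)// enormB.
move: H1; move: (y - y0) (v - y) => a b.
have -> : lm *: - a + (g y0 - g y) = (g y0 - g y) - lm *: a.
  by rewrite addrC scalerN.
have -> : dotv (g y0) a = dotv (g y0 - g y) a + dotv (g y) a.
  by rewrite dotvDl dotvNl subrK.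
move: (g y0 - g y) => c H1 H2 H3 H4.
(* With w = c - lm a, this is Young's inequality for the product of w and b. The squared norm of w
   is at most 2 lm (lm - mu) times that of a, by [H1] and the strong monotonicity obtained from [H2]
   and [H3]. *)
have H5 := dotv_ge0 (c - lm *: a + lm *: b).
rewrite -(ler_pM2l lm0); have H6 := ler_wpM2l (ltW lm0) H4.
have H7 := ler_wpM2l (ltW lm0) (lerD H2 H3).
move: H1 H5 H6 H7; rewrite !exprMn !sqr_enorm !dotvE.
rewrite (dotvC a c) (dotvC b c) (dotvC b a); clear; lra.
Qed.

End Certificates.

(** * Invariants of a run *)

Section Invariants.
Context (R : realType) (m n : nat) (P : saddle R m n) (L mu : R)
  (I : agda_input R m n).
Hypothesis SC : assumption_SC P L mu.
Hypothesis hI : valid_input P mu I.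
Implicit Types s : agda_state R m n.
Local Notation Dg := (edom (sg P)).
Local Notation Dh := (edom (sh P)).

Let gamma_gt0 : 0 < in_gamma I. Proof. by case: hI => _ _ [_ /andP[]]. Qed.

Definition positive_params s : Prop :=
  [/\ 0 < st_mu s, st_mu s < in_l I, in_l I <= st_l s & in_l I <= st_L s].

Lemma tau_gt0 s : positive_params s -> 0 < tau_ I s.
Proof.
case: hI => _ _ [/andP[_ g01] _] _ _ [m0 ml ll lL].
have l0 : 0 < st_l s by lra.
have sm : sigma_ s * st_mu s < 1 by rewrite mulrC ltr_pdivrMr//; lra.
rewrite /tau_ mulr_gt0//; first by rewrite divr_gt0//; lra.
rewrite invr_gt0 ltr_wpDr//; last by rewrite ltr_wpDr ?invr_ge0 ?(ltW gamma_gt0).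
rewrite divr_ge0 ?exprn_ge0 ?(ltW m0)//.
by rewrite !mulr_ge0 ?exprn_ge0//; lra.
Qed.

Definition after_prox_step s : Prop := exists y0,
  [/\ Dh y0, st_y s = y_plus P (st_L s)^-1 (st_x s) y0
    & st_d s = enorm (st_y s - y0)].

(* [y0] and [lm] are the previous [y_t] and the accepted [l_t].  The last
   inequality is what remains of [Lambda + R] once the acceptance test (iv) is
   used to absorb the previous [Delta]. *)
Definition after_accept s : Prop := exists y0 lm,
  [/\ Dh y0, 0 < lm <= st_l s / in_gamma I,
      st_y s = y_plus P lm^-1 (st_x s) y0,
      enorm (grad_y P (st_x s) (st_y s) - grad_y P (st_x s) y0)
        <= lm * enorm (st_y s - y0)
    & (forall q, is_best_response P mu (st_x s) q ->
         enorm (st_y s - q) ^+ 2 <= st_Delta s) /\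
      6 * lm * st_Delta s + (lm - st_mu s) * enorm (st_y s - y0) ^+ 2
        <= st_Lambda s + st_R s].

(** The [near_max] clause is not tied to [AtStep2]: step (3) may return to step (1) with the flag
    set, and then the oracle is not called again. *)
Definition certified s : Prop :=
  [/\ Dg (st_x s), Dh (st_y s),
      st_flag s -> in_max_solver I -> near_max P I (st_x s) (st_y s)
    & st_pc s = AtStep2 ->
      if st_flag s then in_max_solver I = false -> after_prox_step s
      else L <= st_L s -> st_mu s <= mu -> after_accept s].

Lemma sqr_dist_le_diam (y q : 'rV[R]_n) (A : R) : Dh y -> Dh q ->
  enorm (y - q) ^+ 2 <= A ->
  enorm (y - q) ^+ 2 <= fine (mine A%:E (D_bar P I * D_bar P I)%E).
Proof.
move=> hy hq yqA; rewrite /D_bar; case: ifPn => [/andP[_ fin]|_]; last first.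
  by rewrite mulyy minEle leey.
have : ((enorm (y - q))%:E <= ediam Dh)%E.
  by apply: ereal_sup_ubound; exists (y, q).
move: fin; case: (ediam Dh) => //= d _; rewrite lee_fin => yqd.
rewrite -EFinM -EFin_min/= le_min yqA expr2 ler_pM ?enorm_ge0//.
Qed.

(** Stated after [do_step2b], whose output is what the test reads. The cases are oracle and proximal
    reinitialisation, with k = 0, and an accepted step, with k = lm. *)
Lemma certificate s : positive_params s -> certified s -> st_pc s = AtStep2 ->
  L <= st_L s -> st_mu s <= mu ->
  (forall q, is_best_response P mu (st_x s) q ->
     enorm (st_y s - q) ^+ 2 <= st_Delta (do_step2b P I s)) /\
  exists k, [/\ 0 <= k, k <= st_l s / in_gamma I &
    dual_loss P (st_x s) (st_y s) - dual_loss P (st_x s) (yt P I s)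
      + st_mu s / 2 * enorm (yt P I s - st_y s) ^+ 2
      + 6 * k * st_Delta (do_step2b P I s)
    <= st_Lambda (do_step2b P I s) + st_R (do_step2b P I s)
      + k / 2 * enorm (yt P I s - st_y s) ^+ 2].
Proof.
move=> pp [gx hy nmx st2] pc LL mm; have [m0 ml ll lL] := pp.
have l0 : 0 < st_l s by lra.
have L0 : 0 < st_L s by lra.
have hyt : Dh (yt P I s) by apply: (edom_y_plus SC); rewrite invr_gt0.
have [q0 bq0] := best_response_ex SC gx.
have mn0 : mu / 2 * enorm (yt P I s - st_y s) ^+ 2 >=
    st_mu s / 2 * enorm (yt P I s - st_y s) ^+ 2.
  by rewrite ler_wpM2r ?sqr_ge0// ler_wpM2r.
rewrite /do_step2b; move: st2 => /(_ pc); case: (boolP (st_flag s)) => [fl|nfl].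
- case: (boolP (in_max_solver I)) => [ms _|_ /(_ erefl)] /=.
    have cert q bq := near_max_certificate SC gx (nmx fl ms) (q := q) bq m0 mm.
    split=> [q bq|]; first by have [] := cert _ bq.
    exists 0; split=> //; first by rewrite divr_ge0// ltW.
    have [_ /(_ (st_L s) _ hyt ltac:(lra))] := cert _ bq0; lra.
  move=> [y0 [hy0 yE dE]].
  have cert q bq := prox_certificate SC gx hy0 L0 LL (q := q) bq.
  rewrite /= -yE -dE in cert; split=> [q bq|].
    apply: sqr_dist_le_diam => //; first by case: bq.
    have [cq _] := cert _ bq.
    have d0 : 0 <= st_d s by rewrite dE enorm_ge0.
    have A0 : 0 <= (1 + 2 * st_L s / st_mu s) * st_d s.
      by rewrite mulr_ge0// addr_ge0// divr_ge0 ?mulr_ge0// ltW.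
    rewrite -exprMn ler_pXn2r ?nnegrE ?enorm_ge0//.
    rewrite -(ler_pM2l m0); apply: (@le_trans _ _ (2 * st_L s * st_d s)).
      by apply: le_trans cq; rewrite ler_wpM2r// enorm_ge0.
    have -> : st_mu s * ((1 + 2 * st_L s / st_mu s) * st_d s)
      = st_mu s * st_d s + 2 * st_L s * st_d s by field; rewrite gt_eqF.
    by rewrite lerDr mulr_ge0// ltW.
  exists 0; split=> //; first by rewrite divr_ge0// ltW.
  have [_ /(_ _ hyt)] := cert _ bq0; lra.
- move=> /(_ LL mm) [y0 [lm [hy0 /andP[lm0 lml] yE lip [Dq La]]]].
  split=> //; exists lm; split=> //; first exact: ltW.
  have := accepted_certificate SC gx hy0 lm0 (v := yt P I s).
  rewrite /= -yE => /(_ lip hyt).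
  have : (mu - st_mu s) * enorm (st_y s - y0) ^+ 2 >= 0.
    by rewrite mulr_ge0 ?sqr_ge0// subr_ge0.
  move: La mn0; lra.
Qed.

Lemma do_step2bE s : [/\ st_pc (do_step2b P I s) = st_pc s,
  st_t (do_step2b P I s) = st_t s & st_flag (do_step2b P I s) = st_flag s] /\
  [/\ st_x (do_step2b P I s) = st_x s, st_y (do_step2b P I s) = st_y s,
     st_l (do_step2b P I s) = st_l s & st_L (do_step2b P I s) = st_L s] /\
  [/\ st_mu (do_step2b P I s) = st_mu s, st_d (do_step2b P I s) = st_d s,
    xt P I (do_step2b P I s) = xt P I s & yt P I (do_step2b P I s) = yt P I s].
Proof. by rewrite /do_step2b; case: ifP. Qed.

Lemma BC_holds s : positive_params s -> certified s -> st_pc s = AtStep2 ->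
  L <= st_L s -> st_mu s <= mu -> L <= st_l s -> BC P I (do_step2b P I s).
Proof.
move=> pp cs pc LL mm Ll; have [cq [k [k0 kl cert]]] := certificate pp cs pc LL mm.
have [gx hy _ _] := cs; have [q bq] := best_response_ex SC gx.
have yq := cq q bq; have [_ [[Ex Ey El EL] [Em _ _ Eyt]]] := do_step2bE s.
have [m0 ml ll lL] := pp; have mll : st_mu s < st_l s by lra.
move: cert yq Eyt Ex Ey El EL Em; move: (do_step2b P I s) => s1.
move=> cert yq Eyt Ex Ey El EL Em.
have pp1 : positive_params s1 by split; rewrite ?Em ?El ?EL.
rewrite -Eyt -Ex -Ey -Em in cert.
rewrite -Ex in gx bq; rewrite -Ey in hy yq.
rewrite -El in kl Ll mll; rewrite -Em in m0 mm mll.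
exact: (BC_of_certificate SC gamma_gt0 gx hy (tau_gt0 pp1) Ll m0 mll mm bq yq k0 kl cert).
Qed.

End Invariants.

(** Here e and w are the distances of y_t to the old and new best responses, h the displacement
    between these, and z the distance of y_(t+1) to the new one: contraction from w to z, then
    [geometric_drift] on w <= e + h. *)
Lemma distance_recursion (R : realType) (L Lt mu mut l tau D a e h w z : R) :
  0 < mut -> mut <= mu -> mut < l -> L <= Lt -> 0 <= a -> 0 < tau ->
  0 <= h -> 0 <= e -> 0 <= w -> w <= e + h -> e ^+ 2 <= D -> mu * h <= L * a ->
  l * z ^+ 2 <= (l - mu) * w ^+ 2 ->
  z ^+ 2 <= (1 - mut * l^-1 / 2) * D
    + (1 - l^-1 * mut) * (2 - l^-1 * mut) / (l^-1 * mut) * (Lt ^+ 2 / mut ^+ 2)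
      * tau ^+ 2 * (a / tau) ^+ 2.
Proof.
move=> m0 mm ml LL a0 tau0 h0 e0 w0 weh eD hL zw.
have l0 : 0 < l by lra.
have th0 : 0 < l^-1 * mut by rewrite mulr_gt0 ?invr_gt0.
have th1 : l^-1 * mut < 1 by rewrite mulrC ltr_pdivrMr// mul1r.
have hg : h <= Lt / mut * a.
  rewrite mulrAC ler_pdivlMr//.
  have := ler_wpM2r h0 mm; have := ler_wpM2r a0 LL; lra.
have z1 : z ^+ 2 <= (1 - l^-1 * mut) * w ^+ 2.
  rewrite -(ler_pM2l l0); apply: le_trans zw _.
  have -> : l * ((1 - l^-1 * mut) * w ^+ 2) = (l - mut) * w ^+ 2.
    by field; rewrite gt_eqF.
  by rewrite ler_wpM2r ?sqr_ge0//; lra.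
have w1 : w ^+ 2 <= (e + Lt / mut * a) ^+ 2.
  by rewrite ler_pXn2r// ?nnegrE; lra.
apply: le_trans z1 _; apply: (@le_trans _ _ ((1 - l^-1 * mut) * (e + Lt / mut * a) ^+ 2)).
  by rewrite ler_wpM2l//; lra.
apply: le_trans (geometric_drift _ _ th0) _.
have -> : (1 - l^-1 * mut) * (2 - l^-1 * mut) / (l^-1 * mut) * (Lt ^+ 2 / mut ^+ 2)
    * tau ^+ 2 * (a / tau) ^+ 2
  = (1 - l^-1 * mut) * (2 - l^-1 * mut) / (l^-1 * mut) * (Lt / mut * a) ^+ 2.
  by field; rewrite !gt_eqF.
by rewrite lerD2r (mulrC mut) ler_wpM2l//; lra.
Qed.

(** Test (iv) divided by l bounds l b^2 by exactly the terms that accompany 6 l D' and - mut b^2 in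
    Lambda + R. *)
Lemma carried_budget (R : realType) (l mut tau D D' b gX gT : R) : 0 < l ->
  gT = (l * b) ^+ 2 ->
  gT <= 2 * (4 * (1 - l^-1 * mut) / l^-1 ^+ 2 + 2 * l ^+ 2) * D
    + 2 * l ^+ 2 * tau ^+ 2 * gX ->
  6 * l * D' + (l - mut) * b ^+ 2
    <= 6 * l * (D' + 2 * D) - 8 * mut * D
      + (2 * tau ^+ 2 * l * gX - l^-1 ^+ 2 * mut * gT).
Proof.
move=> l0 ->.
have -> : l^-1 ^+ 2 * mut * (l * b) ^+ 2 = mut * b ^+ 2 by field; rewrite gt_eqF.
have -> : (l * b) ^+ 2 = l * (l * b ^+ 2) by ring.
have -> : 2 * (4 * (1 - l^-1 * mut) / l^-1 ^+ 2 + 2 * l ^+ 2) * D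
    + 2 * l ^+ 2 * tau ^+ 2 * gX
  = l * (12 * l * D - 8 * mut * D + 2 * tau ^+ 2 * l * gX).
  by field; rewrite gt_eqF.
rewrite ler_pM2l//; lra.
Qed.

Section InvariantSteps.
Context (R : realType) (m n : nat) (P : saddle R m n) (L mu : R)
  (I : agda_input R m n).
Hypothesis SC : assumption_SC P L mu.
Hypothesis hI : valid_input P mu I.
Implicit Types s : agda_state R m n.
Local Notation Dg := (edom (sg P)).
Local Notation Dh := (edom (sh P)).

Let gamma_gt0 : 0 < in_gamma I. Proof. by case: hI => _ _ [_ /andP[]]. Qed.
Let gamma_lt1 : in_gamma I < 1. Proof. by case: hI => _ _ [_ /andP[]]. Qed.

Lemma gamma1_bounds : 0 < gamma1 I <= 1.
Proof. by rewrite exprn_gt0//= exprn_ile1// ltW. Qed.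

Lemma positive_params_step s s' :
  agda_step P mu I s s' -> positive_params I s -> positive_params I s'.
Proof.
have /andP[g10 g11] := gamma1_bounds.
rewrite /agda_step; case: (st_pc s).
  rewrite /do_step1; case: ifP => _; first case: ifP => _ => [->|[y [_ ->]]] //.
  by move=> ->.
move=> -> [m0 ml ll lL]; have l0 : 0 < in_l I by lra.
case: ifP => [_|_].
  rewrite /do_step2; have [_ [[_ _ El EL] [Em _ _ _]]] := do_step2bE P I s.
  move: El EL Em; move: (do_step2b P I s) => s1 El EL Em.
  case: ifP => _; split; rewrite /= ?El ?EL ?Em //.
    by rewrite le_max lexx orbT.
  by rewrite ler_pdivlMr// (le_trans _ ll)// ger_pMr// ltW.
split; rewrite /= ?El ?EL //.
- by rewrite lt_max mulr_gt0.
- rewrite gt_max; apply/andP; split.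
    by apply: le_lt_trans ml; rewrite ger_pMr.
  (* With [mu] known, [valid_input] identifies the floor with [in_mu I], which is below [in_l I]. *)
  rewrite /mu_low; case: ifP => [k|_] //.
  by have [_ [_ _ iml] _ _ /(_ k) <-] := hI.
- by rewrite ler_pdivlMr// (le_trans _ lL)// ger_pMr.
Qed.

(** Acceptance may occur with l_t < L; tests (ii) and (iii) then supply, at the points reached, the
    inequalities that L <= l_t would have given, and test (iv) supplies the budget. *)
Lemma after_accept_accept s : positive_params I s -> certified P L mu I s ->
  st_pc s = AtStep2 -> st_l s <= st_L s -> L <= st_L s -> st_mu s <= mu ->
  BC P I (do_step2b P I s) -> after_accept P mu I (accept P I (do_step2b P I s)).
Proof.
move=> pp cs pc lLt LL mm bc.
have [Dq _] := certificate SC hI pp cs pc LL mm.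
have [gx hy _ _] := cs; have [m0 ml ll lL] := pp.
have mll : st_mu s < st_l s by lra.
have tau0 := tau_gt0 hI pp.
have Etau : tau_ I (do_step2b P I s) = tau_ I s by rewrite /do_step2b; case: ifP.
have [_ [[Ex Ey El EL] [Em _ Ext Eyt]]] := do_step2bE P I s.
have yE : yt P I s = y_plus P (st_l s)^-1 (xt P I s) (st_y s).
  exact: erefl.
have xE : xt P I s = x_plus P (tau_ I s) (st_x s) (st_y s).
  exact: erefl.
rewrite -Ex -Ey in yE Dq xE gx hy; rewrite -El in mll yE; rewrite -Em in mm m0 mll.
rewrite -EL in LL; rewrite -Etau in xE tau0; rewrite -Ext in yE xE; rewrite -Eyt in yE.
move: bc Dq yE xE gx hy mll mm m0 LL tau0.
move: (do_step2b P I s) => {Ex Ey El EL Em Ext Eyt Etau cs pc pp ml ll lL lLt} {}s.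
move=> bc Dq yE xE gx hy mll mm m0 LL tau0.
have l0 : 0 < st_l s by lra.
have gxt : Dg (xt P I s) by rewrite xE; exact: (edom_x_plus SC).
have [_ bc2 bc3 bc4] := bc.
have EGx : enorm (Gx_t P I s) ^+ 2 = (enorm (xt P I s - st_x s) / tau_ I s) ^+ 2.
  by rewrite xE; exact: enorm_Gx.
have EGt : enorm (Gy_tilde P I s) ^+ 2 = (st_l s * enorm (yt P I s - st_y s)) ^+ 2.
  by rewrite yE; exact: enorm_Gy.
exists (st_y s), (st_l s); split=> //=.
(* The accepted l_t is shrunk by at most gamma; this is the origin of the factor 1/gamma in test
   (i). *)
- rewrite l0/= /gamma2 ler_pdivlMr// le_max; apply/orP; left.
  by rewrite mulrC.
- split=> [q bq|].
  + have [q0 bq0] := best_response_ex SC gx.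
    have H1 := best_response_lipschitz SC gx gxt bq0 bq.
    have H2 := y_plus_contraction SC l0 gxt hy.
    rewrite -yE in H2; have {}H2 := H2 _ bc2 bq.
    have H3 := enorm_triangle q0 (st_y s) q; rewrite (enormB q0) in H3.
    have H4 := distance_recursion m0 mm mll LL (enorm_ge0 _) tau0
      (enorm_ge0 _) (enorm_ge0 _) (enorm_ge0 _) H3 (Dq _ bq0) H1 H2.
    by rewrite -EGx in H4.
  + exact: carried_budget l0 EGt bc4.
Qed.

Lemma certified_step s s' : agda_step P mu I s s' ->
  positive_params I s -> certified P L mu I s -> certified P L mu I s'.
Proof.
move=> st pp; have [m0 ml ll lL] := pp.
(* A rejection only enlarges l_t, so the bound lm <= l_t / gamma survives it. *)
have ll2 : st_l s / in_gamma I <= st_l s / gamma2 I / in_gamma I.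
  rewrite ler_wpM2r ?invr_ge0 ?(ltW gamma_gt0)//.
  by rewrite ler_pdivlMr// ger_pMr ?(ltW gamma_lt1)//; lra.
move=> cs; have [gx hy nmx st2] := cs.
have L'0 : 0 < (st_L s)^-1 by rewrite invr_gt0; lra.
move: st; rewrite /agda_step; case pc : (st_pc s).
  rewrite /do_step1; case: ifP => ms.
    case: ifP => fl.
      by move=> ->; split=> //= [_ _|_]; [exact: nmx|rewrite ms].
    move=> [y [nm ->]]; have [hy' _] := near_max_dual_loss SC gx nm.
    by split=> //= _; rewrite ms.
  move=> ->; split=> //=.
  - exact: (edom_y_plus SC).
  - by rewrite ms.
  - by move=> _ _; exists (st_y s).
(* Step (3) makes the [AtStep2] clause vacuous, which discards any bound obtained with the old L_t
   and mu_t. *)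
move=> ->; case: ifPn => [lLt|_]; last by split.
have [[Epc Et Efl] [[Ex Ey El EL] [Em Ed Ext Eyt]]] := do_step2bE P I s.
rewrite /do_step2; case: ifPn => [/asboolP bc|_].
  split=> /=.
  - by rewrite Ext; apply: (edom_x_plus SC); exact: (tau_gt0 hI pp).
  - by rewrite Eyt; apply: (edom_y_plus SC); rewrite invr_gt0; lra.
  - by [].
  - move=> _ LL mm; rewrite EL in LL; rewrite Em in mm.
    exact: (after_accept_accept pp cs pc lLt LL mm bc).
case fl : (st_flag s).
  split=> /=.
  - by rewrite Ex.
  - by rewrite Ey.
  - by rewrite Efl Ex Ey; exact: nmx.
  - move=> _; rewrite Efl fl => ms; have := st2 pc; rewrite fl => /(_ ms) [y0 [hy0 yE dE]].
    exists y0; split=> /=; first exact: hy0.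
      by rewrite Ey EL Ex.
    by rewrite Ed Ey.
rewrite /do_step2b fl; split=> /=; [exact: gx|exact: hy|by rewrite fl|].
rewrite fl => _ LL mm; have := st2 pc; rewrite fl => /(_ LL mm) [y0 [lm [hy0]]].
move=> /andP[lm0 lml] yE lip H; exists y0, lm; split=> /=.
- exact: hy0.
- by rewrite lm0/=; exact: le_trans lml ll2.
- exact: yE.
- exact: lip.
- exact: H.
Qed.

End InvariantSteps.

(** * Counting *)

Section Counting.
Implicit Types A B : set nat.

Definition count_below A (K : nat) : nat := count (fun i => `[< A i >]) (iota 0 K).

Lemma count_belowS A K : count_below A K.+1 = (count_below A K + `[< A K >])%N.
Proof. by rewrite /count_below -addn1 iotaD count_cat /= add0n addn0. Qed.

Lemma leq_count_below A B K : A `<=` B -> (count_below A K <= count_below B K)%N.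
Proof. by move=> AB; apply: sub_count => i /asboolP/AB ?; apply/asboolP. Qed.

Lemma size_le_count_below A K (s : seq nat) : uniq s ->
  (forall i, i \in s -> A i /\ (i < K)%N) -> (size s <= count_below A K)%N.
Proof.
move=> us sA; rewrite /count_below -size_filter uniq_leq_size// => i /sA[Ai iK].
by rewrite mem_filter mem_iota/= add0n iK andbT; apply/asboolP.
Qed.

(** Every finite subset of [A] lies below some K, so it has at most N elements; an infinite set
    would have a finite subset with more. *)
Lemma counting_le (R : realType) A (N : nat) :
  (forall K, (count_below A K <= N)%N) ->
  finite_set A /\ (counting A <= N%:R%:E :> \bar R)%E.
Proof.
move=> AN.
have bound (B : {fset nat}) : [set` B] `<=` A -> (#|` B| <= N)%N.
  move=> BA; apply: leq_trans (AN (\max_(i <- enum_fset B) i).+1).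
  apply: size_le_count_below; first exact: fset_uniq.
  move=> i iB; split; first exact: BA.
  by rewrite ltnS (big_rem i)//= leq_maxl.
have fA : finite_set A.
  apply: contrapT => /(@infinite_set_fset _ A N.+1)[B /bound + NB].
  by rewrite leqNgt NB.
split=> //; rewrite /counting asboolT// lee_fin ler_nat.
by apply: bound => i /=; rewrite in_fset_set// => /set_mem.
Qed.

Lemma counting_le_below (R : realType) A K : (forall i, A i -> (i < K)%N) ->
  (counting A <= (count_below A K)%:R%:E :> \bar R)%E.
Proof.
move=> AK; apply: (counting_le R _).2 => K'.
rewrite [leqLHS]/count_below -size_filter; apply: size_le_count_below.
  by rewrite filter_uniq// iota_uniq.
by move=> i; rewrite mem_filter => /andP[/asboolP Ai _]; split=> //; exact: AK.
Qed.

(** The budget N is shared by all the sets: the bound on the union makes them all finite below a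
    common K, where disjointness allows exchanging the two sums. *)
Lemma sum_counting_le (R : realType) (A : nat -> set nat) (T N : nat) :
  (forall i j k, A i k -> A j k -> i = j) ->
  (forall K, (count_below [set k | exists2 t, (t < T)%N & A t k] K <= N)%N) ->
  (\sum_(t < T) counting (A t) <= N%:R%:E :> \bar R)%E.
Proof.
move=> dis UN; have [fU _] := counting_le R UN.
have [K UK] : exists K, forall i, (exists2 t, (t < T)%N & A t i) -> (i < K)%N.
  exists (\max_(i <- enum_fset (fset_set [set k | exists2 t, (t < T)%N & A t k])) i).+1.
  move=> i Ui; rewrite ltnS (big_rem i)//= ?leq_maxl//.
  by rewrite in_fset_set//; apply: mem_set.
apply: (@le_trans _ _ (\sum_(t < T) (count_below (A t) K)%:R%:E)%E).
  by apply: lee_sum => t _; apply: counting_le_below => i Ai; apply: UK; exists t.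
rewrite sumEFin lee_fin -natr_sum ler_nat; apply: leq_trans (UN K).
rewrite /count_below; under eq_bigr do rewrite -sum1_count big_mkcond.
rewrite exchange_big -sum1_count [leqRHS]big_mkcond; apply: leq_sum => k _.
case: (asboolP ([set k | exists2 t, (t < T)%N & A t k] k)) => [[t tT Atk]|Nk].
  rewrite (bigD1 (Ordinal tT))//= big1 ?addn0; first by case: asboolP.
  move=> u /eqP ut; case: asboolP => // Auk; case: ut; apply: val_inj.
  exact: dis Auk Atk.
rewrite big1// => t _; case: asboolP => // Atk; case: Nk; by exists t.
Qed.

End Counting.

Lemma limn_esup_le_harmonic (R : realType) (u : (\bar R)^nat) (a b : R) : 0 <= b ->
  (forall T, (u T <= (a + b / T.+1%:R)%:E)%E) -> (limn_esup u <= a%:E)%E.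
Proof.
move=> b0 uab; apply/lee_addgt0Pr => e e0.
have [N bN] : exists N : nat, b / e < N%:R.
  exists (Num.truncn (b / e)).+1; exact: truncnS_gt.
apply: (@le_trans _ _ (ereal_sup (u @` [set k | (N <= k)%N]))).
  by apply: ereal_inf_lbound; exists [set k | (N <= k)%N] => //; exists N.
apply: ge_ereal_sup => _ [k /= Nk <-]; apply: le_trans (uab k) _.
rewrite lee_fin lerD2l ler_pdivrMr// mulrC -ler_pdivrMr//.
by rewrite (le_trans (ltW bN))// ler_nat (leq_trans Nk).
Qed.

(** * Exponents of l_t and L_t along a run *)

Section Complexity.
Context (R : realType) (m n : nat) (P : saddle R m n) (L mu : R)
  (I : agda_input R m n) (s : nat -> agda_state R m n).
Hypothesis SC : assumption_SC P L mu.
Hypothesis hI : valid_input P mu I.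
Hypothesis hrun : agda_run P mu I s.
Local Notation g := (in_gamma I)^-1.
Local Notation r := (in_r I).
Local Notation logR := (logb g (calR I L mu)).

Let mu0 : 0 < mu := SC_mu_gt0 SC.
Let gamma_gt0 : 0 < in_gamma I. Proof. by case: hI => _ _ [_ /andP[]]. Qed.
Let gamma_lt1 : in_gamma I < 1. Proof. by case: hI => _ _ [_ /andP[]]. Qed.
Let g_gt1 : 1 < g. Proof. by rewrite invf_gt1. Qed.
Let g_gt0 : 0 < g. Proof. by rewrite invr_gt0. Qed.
Let l_gt0 : 0 < in_l I. Proof. by case: hI => _ [_ ? ?] _ _ _; lra. Qed.

Lemma lt_logR k : g ^+ k < calR I L mu -> k%:R < logR.
Proof.
move=> gk; rewrite /logb ltr_pdivlMr ?ln_gt0//.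
rewrite mulr_natl -lnXn//.
by rewrite ltr_ln// posrE ?exprn_gt0// (lt_trans _ gk)// exprn_gt0.
Qed.

Lemma logR_ge0 : 0 <= logR.
Proof. by rewrite divr_ge0// ln_ge0// ?(ltW g_gt1)// !le_max lexx !orbT. Qed.

Lemma run_positive_certified k :
  positive_params I (s k) /\ certified P L mu I (s k).
Proof.
have [s0 sS] := hrun; have [[gx hy] [_ m0 ml] _ _ _] := hI.
elim: k => [|k [pp cs]]; first by rewrite s0; split; split.
by split; [exact: positive_params_step (sS k) pp|exact: certified_step (sS k) pp cs].
Qed.

Definition nupd := count_below [set k | updates_L_mu (s k)].
Definition nchk := count_below [set k | checks_BC (s k)].

(** Closed form of mu_t, with k counting powers of gamma: a known [mu] freezes it at the floor,
    while the floor 0 is never reached. *)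
Definition mu_after (k : nat) : R :=
  if in_mu_known I then mu else in_mu I * in_gamma I ^+ k.

(* [j] and [r * nupd k] are the exponents of [l_t] and [L_t] in base
   [1 / gamma], after rescaling by [in_l I]. *)
Definition on_grid k j : Prop :=
  [/\ st_l (s k) = in_l I * g ^+ j,
      st_L (s k) = in_l I * g ^+ (r * nupd k)
    & st_mu (s k) = mu_after (r * nupd k)] /\
  [/\ (j <= (r * nupd k).+1)%N,
      L <= st_L (s k) -> st_mu (s k) <= mu -> (j <= r * nupd k)%N,
      j%:R < logR + 1,
      (r * nupd k)%:R < logR + r%:R
    & (nchk k <= 2 * st_t (s k) + j)%N].

(** The two ways to fail match the first two terms of [calR]: L / in_l and in_mu / mu, the latter
    only when [mu] is unknown. *)
Lemma not_good_lt j :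
  ~ (L <= in_l I * g ^+ j /\ mu_after j <= mu) -> j%:R < logR.
Proof.
move=> ng; apply: lt_logR; rewrite !lt_max.
have [LL|LL] := ltP (in_l I * g ^+ j) L.
  by rewrite [_ < L / _]ltr_pdivlMr// [_ * in_l I]mulrC LL orbT.
have [mm|mm] := ltP mu (mu_after j); last by case: ng.
move: mm; rewrite /mu_after; case: ifP => _; first by rewrite ltxx.
move=> mm; rewrite ltr_pdivlMr// exprVn mulrC ltr_pdivrMr ?exprn_gt0//.
by rewrite mm.
Qed.

Lemma on_grid0 : on_grid 0 0.
Proof.
have [s0 _] := hrun.
have [_ _ _ r0 mk] := hI; rewrite /on_grid s0 /nupd /nchk /count_below/= muln0.
split; split; rewrite /= ?expr0 ?mulr1//.
- by rewrite /mu_after; case: ifP => [/mk|_]; rewrite ?expr0 ?mulr1.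
- by have := logR_ge0; lra.
- by rewrite ltr_wpDl ?logR_ge0// ltr0n.
Qed.

(** An update requires the exponent of l_t to exceed that of L_t. At good states this never happens,
    since a rejection there has l_t < L <= L_t; so an update certifies that the state is not
    good. *)
Lemma on_gridS k j : on_grid k j -> exists j', on_grid k.+1 j'.
Proof.
have [_ sS] := hrun; have [pp cs] := run_positive_certified k.
have r0 : (0 < r)%N by case: hI.
have lg i i' : (in_l I * g ^+ i <= in_l I * g ^+ i') = (i <= i')%N.
  by rewrite ler_pM2l// ler_eXn2l.
move=> [[El EL Em] [j1 j2 j3 k1 c1]].
have := sS k; rewrite /agda_step; case pc : (st_pc (s k)) => st.
  have [E0 E1] : (nupd k.+1 = nupd k)%N /\ (nchk k.+1 = nchk k)%N.
    rewrite /nupd /nchk !count_belowS !asboolF ?addn0//.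
      by rewrite /checks_BC/= pc => -[].
    by rewrite /updates_L_mu/= pc => -[].
  have [F1 F2 F3 F4] : [/\ st_l (s k.+1) = st_l (s k), st_L (s k.+1) = st_L (s k),
      st_mu (s k.+1) = st_mu (s k) & st_t (s k.+1) = st_t (s k)].
    move: st; rewrite /do_step1; case: ifP => _; last by move=> ->.
    by case: ifP => _ => [->|[y [_ ->]]].
  by exists j; rewrite /on_grid E0 E1 F1 F2 F3 F4.
case: (boolP (st_l (s k) <= st_L (s k))) st => lLt st; last first.
  have {}lLt : st_L (s k) < st_l (s k) by rewrite ltNge.
  have E0 : nupd k.+1 = (nupd k).+1.
    by rewrite /nupd count_belowS asboolT ?addn1//=; split.
  have E1 : nchk k.+1 = nchk k.
    rewrite /nchk count_belowS asboolF ?addn0//= => -[_].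
    by rewrite leNgt lLt.
  have jr : (r * nupd k < j)%N by rewrite ltnNge -lg -El -EL -ltNge.
  have rl : (r * nupd k)%:R < logR.
    apply: not_good_lt => -[LL mm]; rewrite -EL in LL; rewrite -Em in mm.
    by have := j2 LL mm; rewrite leqNgt jr.
  (* One grid step of overshoot is absorbed by the update, as r >= 1. *)
  have jS : (j <= r * (nupd k).+1)%N.
    by apply: leq_trans j1 _; rewrite mulnS -add1n leq_add2r.
  exists j; rewrite /on_grid E0 E1 st; split; split=> //=.
  - by rewrite EL /gamma1 -exprVn -mulrA -exprD mulnS addnC.
  - rewrite Em /mu_after /mu_low; case: ifP => known.
      by apply/max_idPr; rewrite ger_pMr// /gamma1 exprn_ile1// ltW.
    rewrite /gamma1 -mulrA -exprD mulnS addnC; apply/max_idPl.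
    rewrite mulr_ge0// ?exprn_ge0// ?ltW//; first by case: hI => _ [].
  - exact: leqW.
  - by rewrite mulnS natrD addrC ltrD2r.
have E0 : nupd k.+1 = nupd k.
  rewrite /nupd count_belowS asboolF ?addn0//= => -[_].
  by rewrite ltNge lLt.
have E1 : nchk k.+1 = (nchk k).+1.
  by rewrite /nchk count_belowS asboolT ?addn1//=; split.
have jr : (j <= r * nupd k)%N by rewrite -lg -El -EL.
have [[_ Et _] [[_ _ El1 EL1] [Em1 _ _ _]]] := do_step2bE P I (s k).
move: st; rewrite /do_step2; case: ifPn => [_|/asboolP nbc] st.
  (* The floor [in_l I] makes the predecessor truncated at 0. The check is paid for by 2 (t + 1) +
     (j - 1) = 2 t + j + 1. *)
  exists j.-1; rewrite /on_grid E0 E1 st /= El1 EL1 Em1 Et; split; split=> //.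
  - rewrite El /gamma2; case: (j) => [|i].
      by rewrite expr0 mulr1 max_r// ger_pMl// ltW.
    rewrite /= exprS mulrCA mulVKf ?gt_eqF//.
    by rewrite max_l// ler_peMr ?exprn_ege1// ltW.
  - by rewrite (leq_trans (leq_pred _))// leqW.
  - by move=> _ _; rewrite (leq_trans (leq_pred _)).
  - by apply: le_lt_trans j3; rewrite ler_nat leq_pred.
  - by move: c1; case: (j) => [|i]; lia.
have lb : L <= st_L (s k) -> st_mu (s k) <= mu -> st_l (s k) < L.
  move=> LL mm; rewrite ltNge; apply/negP => Ll.
  exact: nbc (BC_holds SC hI pp cs pc LL mm Ll).
exists j.+1; rewrite /on_grid E0 E1 st /= El1 EL1 Em1 Et; split; split=> //.
- by rewrite El /gamma2 exprSr mulrA.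
- move=> LL mm; rewrite ltnNge -lg -El -EL -ltNge.
  exact: lt_le_trans (lb LL mm) LL.
- rewrite -natr1 ltrD2r.
  case: (pselect (L <= st_L (s k) /\ st_mu (s k) <= mu)) => [[LL mm]|ng].
    apply: not_good_lt => -[Ll _]; move: (lb LL mm).
    by rewrite El ltNge Ll.
  (* The test is uncontrolled here, but j is at most the exponent of L_t, itself below logR. *)
  rewrite EL Em in ng; apply: le_lt_trans (not_good_lt ng).
  by rewrite ler_nat.
- by move: c1; lia.
Qed.

Lemma on_grid_ex k : exists j, on_grid k j.
Proof. by elim: k => [|k [j /on_gridS]]; [exists 0%N; exact: on_grid0|]. Qed.

(** The strict bound r [nupd] < logR + r gives [nupd] - 1 < logR / r, hence the ceiling. *)
Lemma nupd_le k : (nupd k)%:Z <= Num.ceil (logR / r%:R).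
Proof.
have r0 : 0 < r%:R :> R by rewrite ltr0n; case: hI.
have [j [_ [_ _ _ kr _]]] := on_grid_ex k.
rewrite -ltzD1 addrC -ltrBlDl ceil_gt_int rmorphB/= ltr_pdivlMr//.
by move: kr; rewrite natrM mulrBl mul1r ltrBlDr mulrC.
Qed.

(** At a counted check in iteration t <= T, at most 2 t + j checks precede it, with j < logR + 1;
    adding the check itself gives 2 T + 2 + logR. Other steps leave the count unchanged. *)
Lemma count_checks_le T K :
  (count_below [set k | exists2 t, (t < T.+1)%N & checks_BC (s k) /\ st_t (s k) = t] K)%:R
    <= 2 * T.+1%:R + logR.
Proof.
elim: K => [|K IH].
  by rewrite addr_ge0 ?logR_ge0// mulr_ge0.
rewrite count_belowS; case: asboolP => [[t tT [ck tE]]|_]; last by rewrite addn0.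
have sub : [set k | exists2 t, (t < T.+1)%N & checks_BC (s k) /\ st_t (s k) = t]
    `<=` [set k | checks_BC (s k)] by move=> k [u _ []].
have [j [_ [_ _ j3 _ c1]]] := on_grid_ex K.
have := leq_trans (leq_count_below K sub) c1.
rewrite -(ler_nat R) tE natrD natrM => H.
have : t%:R <= T%:R :> R by rewrite ler_nat.
move: H j3; rewrite addn1 -natr1 -(natr1 T); lra.
Qed.

Lemma avg_checks_le T : (avg_checks s T <= (2 + logR / T.+1%:R)%:E)%E.
Proof.
have T0 : 0 < T.+1%:R :> R by rewrite ltr0n.
pose N := Num.truncn (2 * T.+1%:R + logR).
have N0 : 0 <= 2 * T.+1%:R + logR by rewrite addr_ge0 ?logR_ge0// mulr_ge0.
have : (\sum_(t < T.+1) nb_checks s t <= N%:R%:E)%E.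
  apply: (@sum_counting_le R (fun t => [set k | checks_BC (s k) /\ st_t (s k) = t]))
    => [i j k [_ <-] [_ <-]//|K].
  by rewrite /N truncn_ge_nat// count_checks_le.
move=> H; apply: le_trans (lee_wpmul2l _ H) _; first by rewrite lee_fin invr_ge0.
rewrite -EFinM lee_fin ler_pdivrMl// mulrDr mulrCA mulfV ?gt_eqF// mulr1 mulrC.
by rewrite truncn_le.
Qed.

End Complexity.

Theorem theorem3p3 (R : realType) (m n : nat) (P : saddle R m n) (L mu : R)
    (I : agda_input R m n) (s : nat -> agda_state R m n)
    (hSC : assumption_SC P L mu) (hI : valid_input P mu I)
    (hrun : agda_run P mu I s) :
  let logR := logb (in_gamma I)^-1 (calR I L mu) in
  [/\ (nb_updates s <= (Num.ceil (logR / (in_r I)%:R))%:~R%:E)%E,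
      forall T : nat, (avg_checks s T <= (2 + logR / T.+1%:R)%:E)%E,
      forall T : nat, Num.floor logR <= T%:Z -> (avg_checks s T <= 3%:E)%E
    & (limn_esup (avg_checks s) <= 2%:E)%E].
Proof.
move=> logR; have l0 : 0 <= logR by exact: logR_ge0 hI.
have avg T := avg_checks_le hSC hI hrun T.
split=> //.
- have c0 := nupd_le hSC hI hrun 0; have cK := nupd_le hSC hI hrun.
  (* The bound at step 0 excludes a negative ceiling, so [counting_le] applies to a natural
     number. *)
  move: c0 cK; rewrite -/logR; case: (Num.ceil _) => // N _ cK.
  exact: (counting_le R cK).2.
- move=> T fT; apply: le_trans (avg T) _; rewrite lee_fin -/logR.
  have T1 : logR < T.+1%:R.
    apply: lt_le_trans (floorD1_gt _) _.
    by rewrite -natr1 intrD lerD2r -[leRHS]/(T%:Z%:~R) ler_int.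
  suff : logR / T.+1%:R <= 1 by move: (logR / _) => q; lra.
  by rewrite ler_pdivrMr ?ltr0n// mul1r ltW.
- exact: limn_esup_le_harmonic l0 avg.
Qed.
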